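(* For every $\delta>0$ let $f^\delta\in Y$ satisfy $\|f^\delta-f^\dagger\|\le\delta$, and let $\alpha_*=\alpha_*(\delta,f^\delta)\in(0,\infty]$ be chosen according to the discrepancy principle described in the context (with fixed constants $b>1$, $c>1$). Then $$\|u_{\alpha_*}^\delta-u^\dagger\|\to 0,\qquad \frac{\delta}{\alpha_*^{a/(2a+2)}}\to 0\qquad\text{as }\delta\to 0.$$
   Context: Setting. $X,Y$ are infinite-dimensional Hilbert spaces, norms $\|\cdot\|$. $B: X\supset \mathcal D(B)\to X$ is a self-adjoint, positive definite, unbounded linear operator with dense domain and $\|Bu\|\ge m\|u\|$ for all $u\in\mathcal D(B)$, for some constant $m>0$. For $\tau\in\mathbb R$ put $\|u\|_\tau:=\|B^\tau u\|$ for $u\in X_\tau$, where $X_\tau:=\mathcal D(B^\tau)$ for $\tau>0$ and $X_\tau:=X$ for $\tau\le 0$ (no completion is taken for $\tau<0$). Standing assumptions. $F: X\supset\mathcal D(F)\to Y$ is a (possibly nonlinear) operator such that: (a) $F$ is sequentially continuous on $\mathcal D(F)$ with respect to the weak topologies of $X$ and $Y$; (b) $\mathcal D(F)\subset X$ is closed and convex; (c) $\mathcal D:=\mathcal D(F)\cap X_1$ is non-empty, where $X_1=\mathcal D(B)$; (d) $u^\dagger\in\mathcal D(F)$ satisfies $F(u^\dagger)=f^\dagger$ and is an interior point of $\mathcal D(F)$ (it is not required that $u^\dagger\in X_1$); (e) the data $f^\delta\in Y$ satisfy $\|f^\delta-f^\dagger\|\le\delta$, and the initial guess $\bar u$ lies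 in $\mathcal D$; (f) there are $a>0$ and constants $0<c_a\le C_a<\infty$ with $$c_a\|u-u^\dagger\|_{-a}\le\|F(u)-f^\dagger\|\le C_a\|u-u^\dagger\|_{-a}\quad\text{for all }u\in\mathcal D.$$ Tikhonov regularization. For $0<\alpha<\infty$ let $T_\alpha^\delta(u):=\|F(u)-f^\delta\|^2+\alpha\|u-\bar u\|_1^2$, to be minimized over $u\in\mathcal D(F)$ (with $\|u-\bar u\|_1=+\infty$ if $u\notin X_1$, so minimizers lie in $\mathcal D$). Minimizers exist for each $\alpha>0$ but need not be unique; $u_\alpha^\delta\in\mathcal D$ denotes a minimizer (an arbitrary one, fixed for each $\alpha$ and $\delta$). Discrepancy principle. Let $b>1$ and $c>1$ be finite constants. (1) If $\|F(\bar u)-f^\delta\|\le b\delta$, choose $\alpha_*=\infty$ and set $u_\infty^\delta:=\bar u$. (2) Otherwise choose a finite parameter $\alpha_*>0$ such that $$\|F(u_{\alpha_*}^\delta)-f^\delta\|\le b\delta\le\|F(u_{\beta_*}^\delta)-f^\delta\|\quad\text{for some }\beta_*\text{ with }\alpha_*\le\beta_*\le c\,\alpha_*.$$ Convention: $\delta/\alpha_*^{a/(2a+2)}=0$ if $\alpha_*=\infty$. *)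

(* Defs.v *)
From mathcomp Require Export all_boot all_order all_algebra.
From mathcomp Require Export all_classical all_reals all_analysis.
Export Order.TTheory GRing.Theory Num.Theory.
Export numFieldNormedType.Exports.

Set Implicit Arguments.
Unset Strict Implicit.
Unset Printing Implicit Defensive.

Local Open Scope classical_set_scope.
Local Open Scope ring_scope.

(* Hilbert spaces are real: a complete normed module whose norm comes from an
   inner product [ip : {dot X for idfun}].  Complex spaces are covered through
   the real inner product Re<u, v>, which leaves norms, weak convergence,
   self-adjointness and fractional powers unchanged. *)
Definition hilbert_norm (R : realType) (X : completeNormedModType R)
    (ip : {dot X for idfun}) : Prop :=
  forall u : X, `|u| ^+ 2 = ip u u.

Definition infinite_dimensional (R : realType) (X : lmodType R) : Prop :=
  forall (n : nat) (e : 'I_n -> X),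
    exists u : X, forall c : 'I_n -> R, u <> \sum_(i < n) c i *: e i.

Section Operators.
Context {R : realType} {X : completeNormedModType R}.
Implicit Types (ip : {dot X for idfun}) (D : set X) (B T : X -> X).

(* A partial operator is a pair (D, B); the values of B outside D are junk. *)
Definition linear_on D B : Prop :=
  D 0 /\ forall (k : R) (u v : X), D u -> D v ->
    D (k *: u + v) /\ B (k *: u + v) = k *: B u + B v.

(* The graph of (D, B) is the graph of its adjoint. *)
Definition selfadjoint ip D B : Prop :=
  forall v w : X,
    (D v /\ B v = w) <-> (forall u : X, D u -> ip (B u) v = ip u w).

Definition positive_definite ip D B : Prop :=
  forall u : X, D u -> u != 0 -> 0 < ip (B u) u.

Definition unbounded D B : Prop :=
  ~ exists C : R, forall u : X, D u -> `|B u| <= C * `|u|.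

Definition poly_op (p : {poly R}) T (u : X) : X :=
  \sum_(i < size p) p`_i *: iter i T u.

(* Continuous functional calculus of a bounded positive self-adjoint T, for f
   continuous on [0, +oo[: f(T) u is the common limit of p_n(T) u over the
   polynomial sequences p_n that tend to f uniformly on each [0, M].  The
   spectrum of T lies in such an interval. *)
Definition fun_calc (f : R -> R) T (u : X) : X :=
  get [set v : X | forall p : nat -> {poly R},
    (forall M : R, {uniform `[0, M], (fun n x => (p n).[x]) @ \oo --> f}) ->
    poly_op (p n) T u @[n --> \oo] --> v].

(* For a > 0, B^(-a) = (B^(-1))^a. *)
Definition neg_pow D B (a : R) : X -> X :=
  fun_calc (fun x => x `^ a) ('pinv_(fun=> 0) D B).

Definition norm_neg D B (a : R) (u : X) : R := `|neg_pow D B a u|.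

(* ||u||_1, with the convention ||u||_1 = +oo off X_1 = D(B). *)
Definition norm_one D B (u : X) : \bar R :=
  if u \in D then `|B u|%:E else +oo%E.

End Operators.

Definition weak_cvg (R : realType) (X : normedModType R)
    (x : nat -> X) (l : X) : Prop :=
  forall phi : {linear X -> R^o}, continuous phi ->
    phi (x n) @[n --> \oo] --> phi l.

Section Regularization.
Context {R : realType} {X Y : completeNormedModType R}.

Definition weakly_seq_continuous (DF : set X) (F : X -> Y) : Prop :=
  forall (x : nat -> X) (l : X), (forall n, DF (x n)) -> DF l ->
    weak_cvg x l -> weak_cvg (F \o x) (F l).

(* +oo when u is not in X_1: as ubar lies in X_1, so does u iff u - ubar does. *)
Definition tikhonov (DB : set X) (B : X -> X) (F : X -> Y) (ubar : X)
    (fd : Y) (alpha : R) (u : X) : \bar R :=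
  ((`|F u - fd| ^+ 2)%R%:E + alpha%:E * norm_one DB B (u - ubar)%R ^+ 2)%E.

Definition minimizer (A : set X) (J : X -> \bar R) (u : X) : Prop :=
  A u /\ forall v, A v -> (J u <= J v)%E.

(* u_alpha for alpha in ]0, +oo], with u_(+oo) = ubar. *)
Definition reg_sol (ubar : X) (u : R -> X) (alpha : \bar R) : X :=
  if alpha is r%:E then u r else ubar.

(* [u alpha] is the chosen minimizer for the finite parameter alpha. *)
Definition discrepancy_principle (F : X -> Y) (ubar : X) (b c delta : R)
    (fd : Y) (u : R -> X) (alpha : \bar R) : Prop :=
  if `|F ubar - fd| <= b * delta then alpha = +oo%E
  else exists r : R,
    [/\ alpha = r%:E, 0 < r, `|F (u r) - fd| <= b * delta &
        exists2 s : R, r <= s <= c * r & b * delta <= `|F (u s) - fd|].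

End Regularization.

(* delta / alpha^s, equal to 0 for alpha = +oo. *)
Definition delta_ratio (R : realType) (s delta : R) (alpha : \bar R) : R :=
  if alpha is r%:E then delta / r `^ s else 0.

(* Main.v *)
Require Import Defs.
From mathcomp Require Import ring lra zify.

Set Implicit Arguments.
Unset Strict Implicit.
Unset Printing Implicit Defensive.
Local Open Scope classical_set_scope.
Local Open Scope ring_scope.

(** Write [T] for the inverse of [B], a bounded positive self-adjoint operator
    whose spectrum lies in [0, M] with [M = m^-1], and [S] for its power
    [T ^ a], so that [norm_neg DB B a u] is the norm of [S u].

    Everything about [T] and [S] comes from one fact: a polynomial that is
    nonnegative on [0, M] is positive at [T] ([psd_poly_ge0]).  Up to a small
    constant, such a polynomial is a nonnegative combination of Bernstein
    polynomials, and these are positive at [T] by direct inspection.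
    Applied to [q ^+ 2 + e - p ^+ 2] it turns pointwise inequalities between
    polynomials on [0, M] into inequalities between norms of operator values
    ([poly_op_norm_le]).  Hence polynomials that approximate [x `^ a] uniformly
    converge at [T], and pointwise comparisons with [x `^ a] become comparisons
    with the norm of [S u] ([fun_calc_poly_op_bound], [poly_op_le_fun_calc]).

    The polynomials used are the residuals [r_n] of a Landweber-type iteration
    of order [k >= a + 1], which act as a cutoff at [x] of order [M / n].  Put
    [w = ubar - udag] and [v = udag + r_n(T) w].  Then [v - ubar] is in the
    domain of [B], and the norms of [v - udag], of [n ^ a S (v - udag)] and of
    [B (v - ubar) / n] all tend to 0: they are bounded for every [w], tend to 0
    for [w] in the range of [T], and this range is dense.  The splitting
    [x - udag = (1 - r_n)(T) (x - udag) + r_n(T) (x - ubar) + r_n(T) w] bounds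
    the error of any [x] by a multiple of
    [n ^ a |S (x - udag)| + |B (x - ubar)| / n] plus a null sequence.  Both
    facts are [hilbert_scale_approx].

    Write [alpha = h ^ (2 a + 2)].  Since [udag] is interior, [v] with [n] of
    order [1 / h] competes in the Tikhonov functional, which shows that a
    minimizer has residual at most [delta + o(h ^ a)] and satisfies
    [h ^ (a + 1) |B (u - ubar)| <= delta + o(h ^ a)] ([minimizer_bounds]).  At
    [beta] the residual is at least [b delta] with [b > 1], whence
    [delta = o(h ^ a)] as long as [h] is small; this is the second claim, and
    with the error bound at [n] of order [1 / h] it gives the first one
    ([error_small_parameter]).  As long as [h] stays away from 0, or [alpha] is
    infinite, [B (u - ubar)] is bounded while [S (u - udag)] is [O(delta)], and
    the error bound at a large fixed [n] gives convergence
    ([error_large_parameter]). *)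

(** * Bernstein polynomials *)

Section Bernstein.
Context {R : realType}.
Implicit Types (p g : {poly R}) (n k j : nat).

Definition bernstein n k : {poly R} :=
  ('X^k * (1 - 'X) ^+ (n - k)) *+ 'C(n, k).

Lemma bernstein_ge0 n k (x : R) : 0 <= x <= 1 -> 0 <= (bernstein n k).[x].
Proof.
move=> /andP[x0 x1]; rewrite /bernstein hornerMn hornerM !horner_exp.
rewrite hornerD hornerN hornerX hornerC mulrn_wge0//.
by rewrite mulr_ge0 ?exprn_ge0// subr_ge0.
Qed.

(** A ratio of falling factorials.  The binomial form makes it vanish for
    [k < j] without a case distinction. *)
Definition bcoef n k j : R := 'C(k, j)%:R / 'C(n, j)%:R.

(** As ['C(n, k) * 'C(k, j) = 'C(n, j) * 'C(n - j, k - j)], what is left after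
    taking out ['X^j] is the binomial expansion of [('X + (1 - 'X)) ^+ (n - j)].
    Hence the coefficients of a polynomial in the Bernstein basis are explicit
    sums of numbers [bcoef n k j]. *)
Lemma bernstein_moment n j : (j <= n)%N ->
  \sum_(k < n.+1) bcoef n k j *: bernstein n k = 'X^j.
Proof.
move=> jn.
have C0 : 'C(n, j)%:R != 0 :> R by rewrite pnatr_eq0 -lt0n bin_gt0.
rewrite -(big_mkord xpredT (fun k => bcoef n k j *: bernstein n k)).
rewrite (big_cat_nat _ (n := j)) ?leqW//=.
rewrite big_nat big1 ?add0r; last first.
  by move=> k /andP[_ kj]; rewrite /bcoef bin_small// mul0r scale0r.
have -> : \sum_(j <= k < n.+1) bcoef n k j *: bernstein n k =
   \sum_(0 <= i < (n - j).+1)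
     'X^j * (('X^i * (1 - 'X) ^+ (n - j - i)) *+ 'C(n - j, i)).
  rewrite -{1}[j]add0n big_addn subSn//; apply: eq_big_nat => i /andP[_ ij].
  have ijn : (i + j <= n)%N by lia.
  rewrite /bernstein -mulr_natl -[in RHS]mulr_natl -!polyC_natr -mul_polyC.
  rewrite !mulrA -polyCM.
  have -> : bcoef n (i + j) j * 'C(n, i + j)%:R = 'C(n - j, i)%:R :> R.
    rewrite /bcoef mulrAC; apply: (canLR (mulfK C0)).
    rewrite -!natrM; congr (_%:R).
    have [] : ('C(n, i + j) * 'C(i + j, j) = 'C(n, j) * 'C(n - j, i))%N; last nia.
    apply/eqP; rewrite -(eqn_pmul2r (fact_gt0 j)) -(eqn_pmul2r (fact_gt0 i)).
    rewrite -(eqn_pmul2r (fact_gt0 (n - (i + j)))).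
    have := bin_fact ijn; have := bin_fact (leq_addl i j); have := bin_fact jn.
    have ij' : (i <= n - j)%N by lia.
    have := bin_fact ij'.
    rewrite addnK -subnDA [(j + i)%N]addnC => h1 h2 h3 h4.
    apply/eqP; transitivity (n`!).
      by rewrite -h4 -h3; ring.
    by rewrite -h2 -h1; ring.
  by rewrite -subnDA (addnC j i) exprD ['X^i * 'X^j]mulrC -!mulrA mulrCA.
rewrite -mulr_sumr big_mkord.
have := exprDn (1 - 'X) ('X : {poly R}) (n - j); rewrite subrK expr1n => E.
rewrite [X in _ * X](_ : _ = 1) ?mulr1// [RHS]E; apply: eq_bigr => i _.
by rewrite mulrC.
Qed.

Lemma bernstein_sum1 n : \sum_(k < n.+1) bernstein n k = 1.
Proof.
have := bernstein_moment (leq0n n); rewrite expr0 => <-; apply: eq_bigr => k _.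
by rewrite /bcoef !bin0 divr1 scale1r.
Qed.

Lemma bcoef_bound n k j : (k <= n)%N -> 0 <= bcoef n k j <= 1.
Proof.
move=> kn; rewrite /bcoef divr_ge0//=.
have [jn|nj] := leqP j n; last by rewrite !bin_small// ?mul0r//; lia.
by rewrite ler_pdivrMr ?mul1r ?ltr0n ?bin_gt0// ler_nat leq_bin2l.
Qed.

Lemma bcoefS n k j : (k <= n)%N -> (j < n)%N ->
  bcoef n k j.+1 = bcoef n k j * ((k%:R - j%:R) / (n%:R - j%:R)).
Proof.
move=> kn jn; rewrite /bcoef.
have C0 : 'C(n, j)%:R != 0 :> R by rewrite pnatr_eq0 -lt0n bin_gt0 ltnW.
have C1 : 'C(n, j.+1)%:R != 0 :> R by rewrite pnatr_eq0 -lt0n bin_gt0.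
have nj0 : n%:R - j%:R != 0 :> R by rewrite subr_eq0 eqr_nat gtn_eqF.
have E m : (j.+1%:R * 'C(m, j.+1)%:R = (m%:R - j%:R) * 'C(m, j)%:R :> R).
  have [jm|mj] := leqP j m.
    by rewrite -natrB// -!natrM mul_bin_left.
  by rewrite !bin_small ?mulr0//; lia.
have j0 : j.+1%:R != 0 :> R by rewrite pnatr_eq0.
have En := E n; have Ek := E k.
apply: (mulfI j0); rewrite mulrA Ek.
have -> : 'C(n, j)%:R = j.+1%:R * 'C(n, j.+1)%:R / (n%:R - j%:R) :> R.
  by rewrite En mulrC mulKf.
by field; rewrite nj0 C1 nat1r.
Qed.

(** Passing from [j] to [j + 1] multiplies [bcoef n k j] by [(k - j) / (n - j)],
    which differs from [k / n] by at most [j / (n - j)], uniformly in [k]. *)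
Lemma bcoef_approx j (e : R) : 0 < e -> exists N, forall n k,
  (N <= n)%N -> (k <= n)%N -> `|bcoef n k j - (k%:R / n%:R) ^+ j| <= e.
Proof.
elim: j e => [|j IH] e e0.
  exists 0%N => n k _ _.
  by rewrite /bcoef !bin0 expr0 divr1 subrr normr0 ltW.
have [N1 N1P] := IH _ (divr_gt0 e0 (ltr0n R 2)).
pose N2 := Num.bound (2 * j%:R / e : R).
exists (N1 + N2 + j.+1)%N => n k Nn kn.
have jn : (j < n)%N by lia.
rewrite bcoefS// exprSr.
set c := bcoef _ _ _; set r := k%:R / n%:R.
have /andP[c0 c1] : 0 <= c <= 1 by apply: bcoef_bound.
have n0 : 0 < n%:R :> R by rewrite ltr0n; lia.
have r1 : `|r| <= 1.
  by rewrite /r ger0_norm ?divr_ge0// ler_pdivrMr// mul1r ler_nat.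
have nj0 : 0 < n%:R - j%:R :> R by rewrite subr_gt0 ltr_nat.
set s := (_ / (_ - _)).
have -> : c * s - r ^+ j * r = c * (s - r) + (c - r ^+ j) * r by ring.
apply: (le_trans (ler_normD _ _)); rewrite (normrM c) (normrM (_ - _) r).
have h1 : `|c - r ^+ j| * `|r| <= e / 2.
  by rewrite -[e / 2]mulr1 ler_pM// N1P//; lia.
suff h2 : `|s - r| <= e / 2.
  rewrite [leRHS]splitr lerD// -[leRHS]mul1r ler_pM//.
  by rewrite ger0_norm.
have -> : s - r = - (j%:R * (n%:R - k%:R) / (n%:R * (n%:R - j%:R))).
  by rewrite /s /r; field; rewrite !gt_eqF.
rewrite normrN ger0_norm; last first.
  by rewrite divr_ge0 ?mulr_ge0 ?subr_ge0 ?ler_nat// ltnW.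
rewrite ler_pdivrMr ?mulr_gt0//.
have k0 : 0 <= k%:R :> R by [].
have nN : 2 * j%:R / e <= n%:R - j%:R.
  rewrite -natrB ?(ltnW jn)//.
  have := archi_boundP (divr_ge0 (mulr_ge0 (ler0n R 2) (ler0n R j)) (ltW e0)).
  by move=> /ltW/le_trans; apply; rewrite ler_nat -/N2; lia.
rewrite ler_pdivrMr// in nN.
have jR : 0 <= j%:R :> R by [].
nra.
Qed.

(** The coefficient of [g] at [bernstein n k] tends to [g.[k / n] >= 0] uniformly
    in [k], so it is at least [- e] for large [n].  The point of the identity is
    that, unlike the positivity of [g], it can be evaluated at an operator. *)
Lemma bernstein_posrep g (e : R) :
  (forall x, 0 <= x <= 1 -> 0 <= g.[x]) -> 0 < e ->
  exists n (c : nat -> R), (forall k, (k <= n)%N -> 0 <= c k) /\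
    g + e%:P = \sum_(k < n.+1) c k *: bernstein n k.
Proof.
move=> g0 e0.
pose G := \sum_(j < size g) `|g`_j| + 1.
have G0 : 0 < G by rewrite ltr_wpDl ?sumr_ge0.
have /choice[N NP] : forall j, exists N, forall n k, (N <= n)%N -> (k <= n)%N ->
    `|bcoef n k j - (k%:R / n%:R) ^+ j| <= e / G.
  by move=> j; apply: bcoef_approx; rewrite divr_gt0.
pose n := (\sum_(j < size g) N j + size g).+1.
exists n, (fun k => \sum_(j < size g) g`_j * bcoef n k j + e); split.
  move=> k kn.
  have n0 : 0 < n%:R :> R by rewrite ltr0n.
  have := g0 (k%:R / n%:R); rewrite divr_ge0//= ler_pdivrMr// mul1r ler_nat.
  move=> /(_ kn) gk.
  rewrite -lerBlDr sub0r -(lerD2r (- g.[k%:R / n%:R])).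
  apply: (@le_trans _ _ (- e)); first by rewrite gerDl oppr_le0.
  rewrite horner_coef -sumrB.
  rewrite -lerN2 opprK (le_trans (ler_norm _))// normrN.
  apply: (le_trans (ler_norm_sum _ _ _)).
  apply: (@le_trans _ _ (\sum_(j < size g) `|g`_j| * (e / G))).
    apply: ler_sum => j _; rewrite -mulrBr normrM ler_wpM2l// NP//.
    rewrite /n leqW// (leq_trans _ (leq_addr _ _))//.
    by rewrite (bigD1 j)//= leq_addr.
  rewrite -mulr_suml mulrCA ger_pMr// ler_pdivrMr// mul1r.
  by rewrite lerDl.
under eq_bigr do rewrite scalerDl.
rewrite big_split/= -scaler_sumr bernstein_sum1 alg_polyC; congr (_ + _).
under eq_bigr do rewrite scaler_suml.
rewrite exchange_big/= -[LHS]coefK poly_def; apply: eq_bigr => j _.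
rewrite -(@bernstein_moment n); last by rewrite /n; have := ltn_ord j; lia.
by rewrite scaler_sumr; apply: eq_bigr => k _; rewrite scalerA.
Qed.

(** The error at [x] is at most the mean of [`|f (k / n) - f x|] for the weights
    [(bernstein n k).[x]], hence at most [e / 2] plus [C] times their variance,
    which tends to 0 by [bcoef_approx] for [j = 1, 2].  The quadratic modulus is
    uniform continuity in the form that fits this variance. *)
Lemma weierstrass01 (f : R -> R) :
  (forall e : R, 0 < e -> exists C : R, forall x y, 0 <= x <= 1 -> 0 <= y <= 1 ->
     `|f x - f y| <= e + C * (x - y) ^+ 2) ->
  forall e : R, 0 < e -> exists p, forall x, 0 <= x <= 1 -> `|p.[x] - f x| <= e.
Proof.
move=> fC e e0.
have [C CP] := fC _ (divr_gt0 e0 (ltr0n R 2)).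
pose d := e / 2 / (`|C| + 1).
have d0 : 0 < d by rewrite !divr_gt0// ltr_wpDl.
have [N1 N1P] := bcoef_approx 1 (divr_gt0 d0 (ltr0n R 4)).
have [N2 N2P] := bcoef_approx 2 (divr_gt0 d0 (ltr0n R 4)).
pose n := (N1 + N2 + 2)%N.
have n0 : 0 < n%:R :> R by rewrite ltr0n /n addn2.
exists (\sum_(k < n.+1) f (k%:R / n%:R) *: bernstein n k) => x x01.
pose w k := (bernstein n k).[x].
have w0 k : 0 <= w k by apply: bernstein_ge0.
have m0 : \sum_(k < n.+1) w k = 1.
  by rewrite -horner_sum bernstein_sum1 hornerC.
have mj j : (j <= n)%N -> \sum_(k < n.+1) bcoef n k j * w k = x ^+ j.
  move=> jn; rewrite -hornerXn -(bernstein_moment jn) horner_sum.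
  by apply: eq_bigr => k _; rewrite hornerZ.
pose t (k : nat) : R := k%:R / n%:R.
have t01 k : (k < n.+1)%N -> 0 <= t k <= 1.
  by move=> kn; rewrite /t divr_ge0//= ler_pdivrMr// mul1r ler_nat.
have -> : f x = \sum_(k < n.+1) w k * f x by rewrite -mulr_suml m0 mul1r.
rewrite horner_sum -sumrB.
apply: (le_trans (ler_norm_sum _ _ _)).
apply: (@le_trans _ _ (\sum_(k < n.+1) (e / 2 * w k + `|C| * ((t k - x) ^+ 2 * w k)))).
  apply: ler_sum => k _; rewrite hornerZ -/(w k) -/(t k).
  rewrite [w k * _]mulrC -mulrBl normrM (ger0_norm (w0 k)) mulrA -mulrDl.
  rewrite ler_wpM2r//; apply: (le_trans (CP _ _ (t01 _ (ltn_ord k)) x01)).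
  by rewrite lerD2l ler_wpM2r ?sqr_ge0// ler_norm.
rewrite big_split/= -!mulr_sumr m0 mulr1.
suff var : \sum_(k < n.+1) (t k - x) ^+ 2 * w k <= d.
  rewrite [leRHS]splitr lerD2l; apply: (@le_trans _ _ (`|C| * d)).
    by rewrite ler_wpM2l.
  rewrite /d mulrCA ger_pMr ?divr_gt0// ler_pdivrMr ?mul1r ?lerDl//.
(* The moments of orders 1 and 2 are exact for [bcoef] instead of powers of
   [k / n].  The exchange costs [d / 4] for order 2 and [2 * x * d / 4 <= d / 2]
   for order 1, which is the term [3 / 4]. *)
apply: (@le_trans _ _ (\sum_(k < n.+1) ((bcoef n k 2 * w k - 2 * x * (bcoef n k 1 * w k)
    + x ^+ 2 * w k) + d * w k * (3 / 4)))).
  apply: ler_sum => k _.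
  have h1 := N1P n k _ _; have h2 := N2P n k _ _.
  have {}h1 := h1 _ (ltn_ord k).
  have {}h2 := h2 _ (ltn_ord k).
  have {h1} : `|bcoef n k 1 - t k ^+ 1| <= d / 4 by apply: h1; lia.
  have {h2} : `|bcoef n k 2 - t k ^+ 2| <= d / 4 by apply: h2; lia.
  rewrite !ler_norml expr1 => /andP[a1 a2] /andP[b1 b2].
  have /andP[x0 x1] := x01.
  rewrite (_ : _ + _ =
    (bcoef n k 2 - 2 * x * bcoef n k 1 + x ^+ 2 + d * (3/4)) * w k); last by ring.
  rewrite ler_wpM2r//.
  nra.
rewrite big_split/= big_split/= sumrB -!mulr_sumr -mulr_suml -mulr_sumr m0.
rewrite !mj; [|by rewrite /n; lia..].
lra.
Qed.

(** Write [x = t * y] with [t <= 1].  Then [y `^ a - x `^ a = (1 - t `^ a) * y `^ a]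
    is at most [e] unless [y > rho] and [t < th], and in that case
    [y - x > rho * (1 - th)]. *)
Lemma powR_modulus (a : R) : 0 < a ->
  forall e : R, 0 < e -> exists C : R, forall x y, 0 <= x <= 1 -> 0 <= y <= 1 ->
     `|x `^ a - y `^ a| <= e + C * (x - y) ^+ 2.
Proof.
move=> a0 e e0.
have one_pow b : (1 : R) `^ b = 1 by rewrite powR1.
have pw1 x : 0 <= x <= 1 -> 0 <= x `^ a <= 1.
  move=> /andP[x0 x1]; rewrite powR_ge0/=.
  by rewrite -[leRHS](one_pow a) ge0_ler_powR ?nnegrE// ltW.
have [e1|e1] := leP 1 e.
  exists 0 => x y /pw1/andP[p0 p1] /pw1/andP[q0 q1].
  rewrite mul0r addr0 (le_trans _ e1)// ler_norml; lra.
pose rho := e `^ a^-1; pose th := (1 - e) `^ a^-1.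
have rhoa : rho `^ a = e by rewrite -powRrM mulVf ?gt_eqF// powRr1// ltW.
have tha : th `^ a = 1 - e.
  by rewrite -powRrM mulVf ?gt_eqF// powRr1// subr_ge0 ltW.
have rho0 : 0 < rho by rewrite powR_gt0.
have th0 : 0 < th by rewrite powR_gt0// subr_gt0.
have th1 : th < 1.
  rewrite -[ltRHS](one_pow a^-1) gt0_ltr_powR ?nnegrE ?invr_gt0//.
    by rewrite subr_ge0 ltW.
  by rewrite gtrBl.
pose C := ((rho * (1 - th)) ^+ 2)^-1; exists C => x y.
have C0 : 0 < C by rewrite invr_gt0 exprn_gt0// mulr_gt0// subr_gt0.
wlog xy : x y / x <= y.
  move=> W x01 y01; have [xy|/ltW yx] := leP x y; first exact: W.
  by rewrite distrC -[(x - y) ^+ 2]sqrrN opprB; exact: W.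
move=> x01 y01.
have /andP[p0 p1] := pw1 _ x01; have /andP[q0 q1] := pw1 _ y01.
have Cx0 : 0 <= C * (x - y) ^+ 2 by rewrite mulr_ge0 ?sqr_ge0// ltW.
have /andP[x0 x1] := x01; have /andP[y0 y1] := y01.
have pq : x `^ a <= y `^ a by rewrite ge0_ler_powR ?nnegrE// ltW.
rewrite distrC ger0_norm ?subr_ge0//.
have [yr|ry] := leP y rho.
  have ye : y `^ a <= e by rewrite -rhoa ge0_ler_powR ?nnegrE// ltW.
  by rewrite lerBlDr -[leLHS]addr0 -addrA lerD// addr_ge0.
have yp : 0 < y by exact: lt_trans ry.
pose t := x / y.
have xE : x = t * y by rewrite /t divfK ?gt_eqF.
have t0 : 0 <= t by rewrite divr_ge0.
have [tt|tt] := leP th t.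
  have tae : 1 - e <= t `^ a by rewrite -tha ge0_ler_powR ?nnegrE// ltW.
  have -> : x `^ a = t `^ a * y `^ a by rewrite {1}xE powRM.
  apply: (@le_trans _ _ e); last by rewrite lerDl.
  rewrite -{1}[y `^ a]mul1r -mulrBl -[leRHS]mulr1.
  apply: (@le_trans _ _ (e * y `^ a)); first by rewrite ler_wpM2r// lerBlDl -lerBlDr.
  by rewrite ler_wpM2l// ltW.
suff C1 : 1 <= C * (x - y) ^+ 2.
  apply: (@le_trans _ _ (y `^ a)); first by rewrite gerBl.
  by rewrite (le_trans q1)// (le_trans C1)// lerDr ltW.
rewrite /C mulrC ler_pdivlMr ?exprn_gt0 ?mulr_gt0 ?subr_gt0// mul1r.
rewrite -[(x - y) ^+ 2]sqrrN opprB.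
have h : rho * (1 - th) <= y - x.
  rewrite xE -{1}[y]mul1r -mulrBl mulrC ler_pM ?subr_ge0 ?(ltW rho0)// ?ltW//.
  by rewrite ltrD2l ltrN2.
by rewrite ler_sqr ?nnegrE ?subr_ge0// mulr_ge0 ?subr_ge0 ?ltW.
Qed.

End Bernstein.

(** * Inner products *)

Section InnerProduct.
Context {R : realType} {X : completeNormedModType R} (ip : {dot X for idfun}).
Hypothesis hilb : hilbert_norm ip.
Implicit Types (u v w : X).

Lemma ipC u v : ip u v = ip v u.
Proof. by rewrite hermC expr0 mul1r. Qed.

Lemma ipDl u v w : ip (u + v) w = ip u w + ip v w.
Proof. exact: linearDl. Qed.

Lemma ipZl (k : R) u v : ip (k *: u) v = k * ip u v.
Proof. exact: linearZl_LR. Qed.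

Lemma ipNl u v : ip (- u) v = - ip u v.
Proof. exact: linearNl. Qed.

Lemma ipBl u v w : ip (u - v) w = ip u w - ip v w.
Proof. exact: linearBl. Qed.

Lemma ip0l u : ip 0 u = 0.
Proof. exact: linear0l. Qed.

Lemma ipDr u v w : ip w (u + v) = ip w u + ip w v.
Proof. exact: linearDr. Qed.

Lemma ipZr (k : R) u v : ip v (k *: u) = k * ip v u.
Proof. exact: linearZr_LR. Qed.

Lemma ip_normD u v : `|u + v| ^+ 2 = `|u| ^+ 2 + 2 * ip u v + `|v| ^+ 2.
Proof. by rewrite !hilb ipDl !ipDr (ipC v u); ring. Qed.

Lemma ip_parallelogram u v :
  `|u + v| ^+ 2 + `|u - v| ^+ 2 = 2 * `|u| ^+ 2 + 2 * `|v| ^+ 2.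
Proof. by rewrite !ip_normD normrN (ipC u (- v)) ipNl (ipC v); ring. Qed.

(** The square of the triangle inequality for [u + v]. *)
Lemma ip_cauchy_schwarz u v : ip u v <= `|u| * `|v|.
Proof.
have : `|u + v| ^+ 2 <= (`|u| + `|v|) ^+ 2.
  by rewrite ler_sqr ?nnegrE ?ler_normD// addr_ge0.
by rewrite ip_normD sqrrD -[_ * _ *+ 2]mulr_natl lerD2r lerD2l ler_pM2l.
Qed.

Lemma ip_cvgl (x : nat -> X) l v : x n @[n --> \oo] --> l ->
  ip (x n) v @[n --> \oo] --> ip l v.
Proof.
move=> /cvgrPdist_le xl; apply/cvgrPdist_le => e e0.
have d0 : 0 < e / (`|v| + 1) by rewrite divr_gt0// ltr_wpDl.
have := xl _ d0; apply: filterS => n h.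
have h' : `|l - x n| * `|v| <= e.
  apply: (le_trans (ler_wpM2r _ h)) => //.
  by rewrite mulrAC -mulrA ger_pMr// ler_pdivrMr ?mul1r ?lerDl// ltr_wpDl.
rewrite -ipBl ler_norml lerNl -ipNl.
by rewrite !(le_trans (ip_cauchy_schwarz _ _))// normrN.
Qed.

End InnerProduct.

(** * Polynomials of an operator *)

Section PolynomialCalculus.
Context {R : realType} {X : completeNormedModType R} (T : X -> X).
Hypothesis T_lin : linear T.
Implicit Types (p q : {poly R}) (u v : X) (k : R).

(** Two polynomials of different sizes can be compared term by term only after
    padding to a common length. *)
Lemma poly_op_widen n p u : (size p <= n)%N ->
  poly_op p T u = \sum_(i < n) p`_i *: iter i T u.
Proof.
move=> pn; rewrite /poly_op.
rewrite -(big_mkord xpredT (fun i => p`_i *: iter i T u)).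
rewrite -(big_mkord xpredT (fun i => p`_i *: iter i T u)).
rewrite [RHS](big_cat_nat _ (n := size p))//=.
rewrite [X in _ + X]big_nat [X in _ + X]big1 ?addr0// => i /andP[pi _].
by rewrite nth_default// scale0r.
Qed.

Lemma poly_opD p q u : poly_op (p + q) T u = poly_op p T u + poly_op q T u.
Proof.
pose n := maxn (size p) (size q).
rewrite (@poly_op_widen n)//; last exact: size_polyD.
rewrite (@poly_op_widen n p) ?leq_maxl// (@poly_op_widen n q) ?leq_maxr//.
by rewrite -big_split; apply: eq_bigr => i _; rewrite coefD scalerDl.
Qed.

Lemma poly_opZ k p u : poly_op (k *: p) T u = k *: poly_op p T u.
Proof.
rewrite (@poly_op_widen (size p)) ?size_scale_leq//.
by rewrite scaler_sumr; apply: eq_bigr => i _; rewrite coefZ scalerA.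
Qed.

Lemma poly_opC k u : poly_op k%:P T u = k *: u.
Proof.
by rewrite (@poly_op_widen 1) ?size_polyC_leq1// big_ord1 coefC.
Qed.

Lemma poly_opN p u : poly_op (- p) T u = - poly_op p T u.
Proof. by rewrite -scaleN1r poly_opZ scaleN1r. Qed.

Lemma poly_opB p q u : poly_op (p - q) T u = poly_op p T u - poly_op q T u.
Proof. by rewrite poly_opD poly_opN. Qed.

Lemma poly_opMX p u : poly_op (p * 'X) T u = poly_op p T (T u).
Proof.
rewrite (@poly_op_widen (size p).+1); last first.
  by rewrite (leq_trans (size_polyMleq _ _))// size_polyX addn2.
rewrite big_ord_recl coefMX eqxx scale0r add0r; apply: eq_bigr => i _.
by rewrite coefMX/= -iterSr.
Qed.

Lemma poly_opX u : poly_op 'X T u = T u.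
Proof. by rewrite -['X]mul1r poly_opMX (poly_opC 1) scale1r. Qed.

Lemma poly_op_linear p : linear (poly_op p T).
Proof.
move=> k u v; elim/poly_ind: p u v => [|p c IH] u v.
  by rewrite !(poly_opC 0) !scale0r scaler0 addr0.
rewrite !poly_opD !poly_opMX !poly_opC T_lin IH !scalerDr !scalerA (mulrC c).
by rewrite addrACA.
Qed.

Lemma poly_op0 p : poly_op p T 0 = 0.
Proof.
by have := poly_op_linear p (-1) 0 0; rewrite scaler0 addr0 scaleN1r addNr.
Qed.

Lemma poly_opM p q u : poly_op (p * q) T u = poly_op p T (poly_op q T u).
Proof.
elim/poly_ind: q u => [|q c IH] u.
  by rewrite mulr0 !(poly_opC 0) !scale0r poly_op0.
rewrite mulrDr mulrA poly_opD poly_opMX IH -[p * c%:P]mulrC mul_polyC poly_opZ.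
by rewrite poly_opD poly_opMX poly_opC [in RHS]addrC poly_op_linear addrC.
Qed.

Lemma poly_op_add p u v : poly_op p T (u + v) = poly_op p T u + poly_op p T v.
Proof. by rewrite -[u]scale1r poly_op_linear !scale1r. Qed.

End PolynomialCalculus.

(** * Positivity of polynomials of a positive operator *)

Section Positivity.
Context {R : realType} {X : completeNormedModType R} (ip : {dot X for idfun}).
Hypothesis hilb : hilbert_norm ip.
Context (T : X -> X) (M : R).
Hypotheses (T_lin : linear T) (T_sym : forall u v, ip (T u) v = ip u (T v)).
Hypotheses (T_psd : forall u, 0 <= ip (T u) u).
Hypotheses (M_gt0 : 0 < M) (T_bound : forall u, `|T u| <= M * `|u|).
Implicit Types (p q g : {poly R}) (u v : X).

Lemma poly_op_sym p u v : ip (poly_op p T u) v = ip u (poly_op p T v).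
Proof.
elim/poly_ind: p u v => [|p c IH] u v.
  by rewrite !(poly_opC _ 0) !scale0r ip0l ipC ip0l.
rewrite !poly_opD !poly_opMX !poly_opC ipDl ipDr ipZl ipZr.
have E : T (poly_op p T v) = poly_op p T (T v).
  by rewrite -(poly_opX T (poly_op _ _ _)) -poly_opM// mulrC poly_opMX.
by rewrite IH T_sym E.
Qed.

Definition psd_poly p := forall u, 0 <= ip (poly_op p T u) u.

Lemma psd_polyD p q : psd_poly p -> psd_poly q -> psd_poly (p + q).
Proof. by move=> hp hq u; rewrite poly_opD ipDl addr_ge0. Qed.

Lemma psd_polyZ c p : 0 <= c -> psd_poly p -> psd_poly (c *: p).
Proof. by move=> c0 hp u; rewrite poly_opZ ipZl mulr_ge0. Qed.

Lemma psd_poly_sqrM p q : psd_poly p -> psd_poly (q ^+ 2 * p).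
Proof.
by move=> hp u; rewrite expr2 -mulrA [q * p]mulrC !poly_opM// poly_op_sym.
Qed.

Lemma psd_poly1 : psd_poly 1.
Proof. by move=> u; rewrite (poly_opC _ 1) scale1r -hilb sqr_ge0. Qed.

Lemma psd_polyX : psd_poly 'X.
Proof. by move=> u; rewrite poly_opX. Qed.

Lemma psd_polyMX : psd_poly (M%:P - 'X).
Proof.
move=> u; rewrite poly_opB poly_opC poly_opX ipBl ipZl -hilb.
rewrite subr_ge0 (le_trans (ip_cauchy_schwarz hilb _ _))//.
by rewrite expr2 mulrA ler_wpM2r.
Qed.

(** Even powers are squares and can be removed, which leaves exponents 0 and 1.
    The product of both factors is positive because
    [M * x * (M - x) = x ^+ 2 * (M - x) + (M - x) ^+ 2 * x]. *)
Lemma psd_poly_monomial k l : psd_poly ('X^k * (M%:P - 'X) ^+ l).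
Proof.
set Z := M%:P - 'X.
have -> : 'X^k * Z ^+ l =
    ('X^(k./2) * Z ^+ l./2) ^+ 2 * ('X ^+ (odd k) * Z ^+ (odd l)).
  rewrite -{1}(odd_double_half k) -{1}(odd_double_half l) -!muln2.
  by rewrite !exprD !exprM; ring.
apply: psd_poly_sqrM.
case: (odd k) (odd l) => -[]; rewrite ?expr0 ?expr1 ?mul1r ?mulr1; last 3 first.
- exact: psd_polyX.
- exact: psd_polyMX.
- exact: psd_poly1.
have -> : 'X * Z = M^-1 *: ('X ^+ 2 * Z + Z ^+ 2 * 'X).
  rewrite -mul_polyC (_ : _ + _ = M%:P * ('X * Z)).
    by rewrite [RHS]mulrA -polyCM mulVf ?gt_eqF// mul1r.
  by rewrite /Z; ring.
apply: psd_polyZ; first by rewrite invr_ge0 ltW.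
by apply: psd_polyD; apply: psd_poly_sqrM; [exact: psd_polyMX|exact: psd_polyX].
Qed.

Lemma psd_poly_sum n (F : nat -> {poly R}) :
  (forall k, (k < n)%N -> psd_poly (F k)) -> psd_poly (\sum_(k < n) F k).
Proof.
elim: n => [|n IH] h; rewrite ?big_ord0 ?big_ord_recr/=.
  by move=> u; rewrite (poly_opC _ 0) scale0r ip0l.
by apply: psd_polyD; [apply: IH => k kn; apply: h; lia|exact: h].
Qed.

(** This replaces the spectral theorem.  Rescaled to [0, 1] and up to a small
    constant, [g] is a nonnegative combination of Bernstein polynomials, which
    are multiples of ['X^k * (M%:P - 'X) ^+ l] after scaling back. *)
Lemma psd_poly_ge0 g : (forall x, 0 <= x <= M -> 0 <= g.[x]) -> psd_poly g.
Proof.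
move=> g0 u; apply/ler_addgt0Pr => e e0.
pose G := g \Po (M *: 'X).
have G0 x : 0 <= x <= 1 -> 0 <= G.[x].
  move=> /andP[x0 x1]; rewrite /G horner_comp hornerZ hornerX g0//.
  by rewrite mulr_ge0 ?(ltW M_gt0)//= ger_pMr.
(* The constant added to [g] costs its multiple by [`|u| ^+ 2], at most [e]. *)
have d0 : 0 < e / (`|u| ^+ 2 + 1) by rewrite divr_gt0// ltr_wpDl// sqr_ge0.
set d := e / _ in d0.
have [n [c [c0 cE]]] := bernstein_posrep G0 d0.
have GE : g + d%:P = (G + d%:P) \Po (M^-1 *: 'X).
  rewrite comp_polyD comp_polyC -comp_polyA comp_polyZ comp_polyX scalerA.
  by rewrite mulfV ?gt_eqF// scale1r comp_polyXr.
have psd : psd_poly (g + d%:P).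
  rewrite GE cE linear_sum/=.
  apply: (@psd_poly_sum _ (fun k => (c k *: bernstein n k) \Po (M^-1 *: 'X))).
  move=> k kn; rewrite comp_polyZ; apply: psd_polyZ; first exact: c0.
  rewrite /bernstein -mulr_natl -polyC_natr mul_polyC comp_polyZ comp_polyM.
  apply: psd_polyZ => //.
  rewrite comp_Xn_poly rmorphXn/= comp_polyD linearN/= (comp_polyC 1) comp_polyX.
  have -> : 1%:P - M^-1 *: 'X = M^-1 *: (M%:P - 'X) :> {poly R}.
    by rewrite scalerBr -[M%:P]alg_polyC scalerA mulVf ?gt_eqF// scale1r.
  rewrite !exprZn -scalerAl -scalerAr.
  by do 2!(apply: psd_polyZ; first by rewrite exprn_ge0// invr_ge0 ltW);
    exact: psd_poly_monomial.
have := psd u; rewrite poly_opD poly_opC ipDl ipZl -hilb.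
move=> /le_trans; apply; rewrite lerD2l /d mulrAC -mulrA ger_pMr//.
by rewrite ler_pdivrMr ?mul1r ?lerDl// ltr_wpDl// sqr_ge0.
Qed.

(** Positivity of [q ^+ 2 + e - p ^+ 2] at [T]. *)
Lemma poly_op_norm_le p q e u :
  (forall x, 0 <= x <= M -> p.[x] ^+ 2 <= q.[x] ^+ 2 + e) ->
  `|poly_op p T u| ^+ 2 <= `|poly_op q T u| ^+ 2 + e * `|u| ^+ 2.
Proof.
move=> pq; have := @psd_poly_ge0 (q ^+ 2 + e%:P - p ^+ 2) _ u.
rewrite poly_opB poly_opD poly_opC !expr2 !poly_opM// ipBl ipDl/=.
rewrite ipZl (poly_op_sym q) (poly_op_sym p) -!hilb !expr2 subr_ge0.
apply => x xM; rewrite !hornerE subr_ge0 -!expr2; exact: pq.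
Qed.

Lemma poly_op_norm_bound p C u : 0 <= C ->
  (forall x, 0 <= x <= M -> `|p.[x]| <= C) -> `|poly_op p T u| <= C * `|u|.
Proof.
move=> C0 pC; have := @poly_op_norm_le p 0 (C ^+ 2) u.
rewrite (poly_opC _ 0) scale0r normr0 expr0n add0r -exprMn => h.
rewrite -ler_sqr ?nnegrE ?mulr_ge0//; apply: h => x xM.
by rewrite hornerC expr0n add0r -real_normK ?num_real// ler_sqr ?nnegrE// pC.
Qed.

End Positivity.

(** * Polynomial approximation of real powers *)

Section Convergence.
Context {R : realType}.

Lemma uniform_cvgP (h : nat -> R -> R) (f : R -> R) (A : set R) :
  {uniform A, h @ \oo --> f} <->
  forall e : R, 0 < e ->
    exists N, forall n x, (N <= n)%N -> A x -> `|f x - h n x| <= e.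
Proof.
split=> [hf e e0|hf].
  have : nbhs (f : {uniform` A -> R}) [set g | forall x, A x -> ball (f x) e (g x)].
    apply/uniform_nbhs; exists [set xy | ball xy.1 e xy.2]; split; last by [].
    by rewrite -entourage_ballE; exists e.
  move=> /hf[N _ NP].
  by exists N => n x Nn Ax; apply/ltW/NP.
move=> P /uniform_nbhs[E [+ EP]]; rewrite -entourage_ballE => -[e/= e0 eE].
have [N NP] := hf _ (divr_gt0 e0 (ltr0n R 2)).
exists N => // n Nn; apply: EP => y Ay; apply: eE; apply: (le_lt_trans (NP _ _ Nn Ay)).
by rewrite ltr_pdivrMr// ltr_pMr// ltr1n.
Qed.

Lemma cauchy_norm_cvg (X : completeNormedModType R) (x : nat -> X) :
  (forall e : R, 0 < e -> exists N, forall i j, (N <= i)%N -> (N <= j)%N ->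
     `|x i - x j| <= e) -> exists l : X, x n @[n --> \oo] --> l.
Proof.
move=> hx; suff /cauchy_cvg/cvg_ex[l xl] : cauchy (x @ \oo) by exists l.
apply: cauchy_exP => e e0.
have [N NP] := hx _ (divr_gt0 e0 (ltr0n R 2)).
exists (x N), N => // n Nn; rewrite /= -ball_normE /=.
apply: (le_lt_trans (NP _ _ (leqnn N) Nn)).
by rewrite ltr_pdivrMr// ltr_pMr// ltr1n.
Qed.

Lemma poly_bounded (q : {poly R}) (M : R) :
  exists2 Q : R, 0 <= Q & forall x, 0 <= x <= M -> `|q.[x]| <= Q.
Proof.
exists (\sum_(i < size q) `|q`_i| * `|M| ^+ i) => [|x /andP[x0 xM]].
  by apply: sumr_ge0 => i _; rewrite mulr_ge0 ?exprn_ge0.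
rewrite horner_coef (le_trans (ler_norm_sum _ _ _))//; apply: ler_sum => i _.
rewrite normrM ler_wpM2l// normrX lerXn2r ?nnegrE//.
by rewrite ger0_norm// (le_trans xM)// ler_norm.
Qed.

(** The [n]-th polynomial is within [1 / (n + 1)] of the power on [0, n + 1], so
    that one sequence serves all bounded intervals. *)
Lemma powR_poly_approx (a : R) : 0 < a -> exists p : nat -> {poly R},
  forall M, {uniform `[0, M], (fun n x => (p n).[x]) @ \oo --> (fun x => x `^ a)}.
Proof.
move=> a0.
have /choice[p pP] : forall n : nat, exists p : {poly R},
    forall x, 0 <= x <= n.+1%:R -> `|x `^ a - p.[x]| <= n.+1%:R^-1.
  move=> n; set s : R := n.+1%:R.
  have s0 : 0 < s by rewrite ltr0n.
  have sa0 : 0 < s `^ a by rewrite powR_gt0.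
  have [|q qP] := weierstrass01 (powR_modulus a0) (e := s^-1 / s `^ a).
    by rewrite divr_gt0 ?invr_gt0.
  exists (s `^ a *: (q \Po (s^-1 *: 'X))) => x /andP[x0 xs].
  have xs01 : 0 <= s^-1 * x <= 1.
    by rewrite mulr_ge0 ?invr_ge0 ?(ltW s0)//= mulrC ler_pdivrMr// mul1r.
  rewrite hornerZ horner_comp hornerZ hornerX.
  have -> : x `^ a = s `^ a * (s^-1 * x) `^ a.
    rewrite -powRM ?(ltW s0)//; last by case/andP: xs01.
    by rewrite mulrA mulfV ?gt_eqF// mul1r.
  rewrite -mulrBr normrM ger0_norm ?(ltW sa0)// distrC.
  by rewrite mulrC -ler_pdivlMr// qP.
exists p => M; apply/uniform_cvgP => e e0.
pose N := Num.bound M; pose N' := Num.bound (e^-1).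
exists (N + N')%N => n x Nn; rewrite /= in_itv/= => /andP[x0 xM].
apply: (le_trans (pP n x _)).
  rewrite x0 (le_trans xM)// (le_trans (ler_norm _))//.
  rewrite (le_trans (ltW (archi_boundP (normr_ge0 M))))//.
  rewrite (_ : Num.bound `|M| = N); first by rewrite ler_nat; lia.
  by rewrite /N /Num.bound normr_id.
rewrite -[e]invrK lef_pV2 ?posrE ?invr_gt0//.
have e1 : 0 <= e^-1 by rewrite invr_ge0 ltW.
rewrite (le_trans (ltW (archi_boundP e1)))// ler_nat -/N'; lia.
Qed.

End Convergence.

(** * Continuous functions of a positive operator *)

Section FunctionalCalculus.
Context {R : realType} {X : completeNormedModType R} (ip : {dot X for idfun}).
Hypothesis hilb : hilbert_norm ip.
Context (T : X -> X) (M : R).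
Hypotheses (T_lin : linear T) (T_sym : forall u v, ip (T u) v = ip u (T v)).
Hypotheses (T_psd : forall u, 0 <= ip (T u) u).
Hypotheses (M_gt0 : 0 < M) (T_bound : forall u, `|T u| <= M * `|u|).
Context (f : R -> R) (f_approx : exists p : nat -> {poly R}, forall M',
  {uniform `[0, M'], (fun n x => (p n).[x]) @ \oo --> f}).
Implicit Types (p q g : {poly R}) (u v : X).

(** Two approximating sequences are uniformly close to each other on [0, M], so
    their values at [T] are close in norm.  Comparing one sequence with itself
    gives a limit, comparing it with the others shows that the limit is shared. *)
Lemma fun_calc_cvg (p : nat -> {poly R}) u :
  (forall M', {uniform `[0, M'], (fun n x => (p n).[x]) @ \oo --> f}) ->
  poly_op (p n) T u @[n --> \oo] --> fun_calc f T u.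
Proof.
have bound q q' e : 0 <= e ->
    (forall x : R, 0 <= x <= M -> `|q.[x] - q'.[x]| <= e) ->
    `|poly_op q T u - poly_op q' T u| <= e * `|u|.
  move=> e0 qq; rewrite -poly_opB.
  apply: (poly_op_norm_bound hilb T_lin T_sym T_psd M_gt0 T_bound) => // x xM.
  by rewrite hornerD hornerN qq.
suff [v vP] : exists v : X, forall p : nat -> {poly R},
    (forall M', {uniform `[0, M'], (fun n x => (p n).[x]) @ \oo --> f}) ->
    poly_op (p n) T u @[n --> \oo] --> v.
  move=> hp; apply: (@getPex _ [set v : X | forall p : nat -> {poly R},
    (forall M : R, {uniform `[0, M], (fun n x => (p n).[x]) @ \oo --> f}) ->
    poly_op (p n) T u @[n --> \oo] --> v]) => //; by exists v.
have [p0 p0f] := f_approx.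
have u1 : 0 < `|u| + 1 by rewrite ltr_wpDl.
have pw (p1 : nat -> {poly R}) e : 0 < e ->
    (forall M', {uniform `[0, M'], (fun n x => (p1 n).[x]) @ \oo --> f}) ->
    exists N, forall i j, (N <= i)%N -> (N <= j)%N ->
      `|poly_op (p0 i) T u - poly_op (p1 j) T u| <= e.
  move=> e0 p1f; have d0 : 0 < e / (`|u| + 1) by rewrite divr_gt0.
  have [N0 N0P] := (uniform_cvgP _ _ _).1 (p0f M) _ (divr_gt0 d0 (ltr0n R 2)).
  have [N1 N1P] := (uniform_cvgP _ _ _).1 (p1f M) _ (divr_gt0 d0 (ltr0n R 2)).
  exists (N0 + N1)%N => i j Ni Nj.
  apply: (le_trans (bound _ _ (e / (`|u| + 1)) (ltW d0) _)).
    move=> x xM; have xM' : `[0, M]%classic x by rewrite /= in_itv.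
    rewrite [leRHS]splitr -(subrKA (f x)) (le_trans (ler_normD _ _))// lerD//.
      by rewrite distrC N0P//; lia.
    by rewrite N1P//; lia.
  by rewrite mulrAC -mulrA ger_pMr// ler_pdivrMr ?mul1r ?lerDl.
have [v vP] : exists v : X, poly_op (p0 n) T u @[n --> \oo] --> v.
  by apply: cauchy_norm_cvg => e e0; exact: pw.
exists v => p1 p1f; apply/cvgrPdist_le => e e0.
have e20 := divr_gt0 e0 (ltr0n R 2).
have [N NP] := pw _ _ e20 p1f.
move/cvgrPdist_le: vP => /(_ _ e20)[N' _ N'P].
exists (N + N')%N => // j /= Nj.
rewrite [leRHS]splitr -(subrKA (poly_op (p0 (N + N')%N) T u)).
rewrite (le_trans (ler_normD _ _))// lerD//.
  by apply: N'P; rewrite /= leq_addl.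
by apply: NP; [exact: leq_addr|lia].
Qed.

Lemma fun_calc_norm_cvg u (p : nat -> {poly R}) :
  (forall M', {uniform `[0, M'], (fun n x => (p n).[x]) @ \oo --> f}) ->
  `|poly_op (p n) T u| @[n --> \oo] --> `|fun_calc f T u|.
Proof. by move=> pf; apply: cvg_norm; exact: fun_calc_cvg. Qed.

Lemma fun_calc_linear : linear (fun_calc f T).
Proof.
move=> k u v; have [p pf] := f_approx.
have hu := @fun_calc_cvg p u pf; have hv := @fun_calc_cvg p v pf.
have huv := @fun_calc_cvg p (k *: u + v) pf.
have E : (fun n => poly_op (p n) T (k *: u + v)) =
    (fun n => k *: poly_op (p n) T u + poly_op (p n) T v).
  by apply/funext => n; rewrite poly_op_linear.
apply: (cvg_unique _ huv) => //=; rewrite E.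
by apply: cvgD => //; apply: cvgZr.
Qed.

(** The operator on the left is the limit of [(p_n * q)(T)] for polynomials [p_n]
    that tend to [f], and [p_n * q] is bounded by [C + o(1)] on [0, M]. *)
Lemma fun_calc_poly_op_bound q (C : R) u : 0 <= C ->
  (forall x : R, 0 <= x <= M -> `|f x * q.[x]| <= C) ->
  `|fun_calc f T (poly_op q T u)| <= C * `|u|.
Proof.
move=> C0 fq; have [p pf] := f_approx.
have [Q Q0 qQ] := poly_bounded q M.
apply/ler_addgt0Pr => e e0.
have d0 : 0 < e / (`|u| + 1) / (Q + 1) by rewrite !divr_gt0// ltr_wpDl.
have [N NP] := (uniform_cvgP _ _ _).1 (pf M) _ d0.
have Su := @fun_calc_norm_cvg (poly_op q T u) p pf.
apply: (cvgr_to_le Su); exists N => // n /= Nn.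
rewrite -poly_opM//.
apply: (@le_trans _ _ ((C + e / (`|u| + 1)) * `|u|)); last first.
  rewrite mulrDl lerD2l mulrAC -mulrA ger_pMr// ler_pdivrMr ?mul1r ?lerDl//.
apply: (poly_op_norm_bound hilb T_lin T_sym T_psd M_gt0 T_bound).
  by rewrite addr_ge0// divr_ge0// ?addr_ge0// ltW.
move=> x xM; rewrite hornerM.
rewrite (_ : _ * _ = f x * q.[x] - (f x - (p n).[x]) * q.[x]); last by ring.
rewrite (le_trans (ler_normB _ _))// lerD// ?fq// normrM.
have xM' : `[0, M]%classic x by rewrite /= in_itv.
rewrite (le_trans (ler_pM _ _ (NP _ _ Nn xM') (qQ _ xM)))//.
rewrite -[leLHS]mulrA ger_pMr ?divr_gt0 ?ltr_wpDl// mulrC ler_pdivrMr ?ltr_wpDl//.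
by rewrite mul1r lerDl.
Qed.

(** On [0, M] one has [q ^+ 2 <= C ^+ 2 * f ^+ 2 <= (C * p_n) ^+ 2 + o(1)], as [f]
    is bounded there and [p_n] tends to [f] uniformly; then [poly_op_norm_le]
    applies and passes to the limit. *)
Lemma poly_op_le_fun_calc q (C : R) u : 0 <= C ->
  (forall x : R, 0 <= x <= M -> `|q.[x]| <= C * `|f x|) ->
  `|poly_op q T u| <= C * `|fun_calc f T u|.
Proof.
move=> C0 qf; have [p pf] := f_approx.
rewrite -ler_sqr ?nnegrE ?mulr_ge0// exprMn; apply/ler_addgt0Pr => e e0.
have [N1 N1P] := (uniform_cvgP _ _ _).1 (pf M) _ ltr01.
have [Q Q0 qQ] := poly_bounded (p N1) M.
(* As [`|f| <= Q + 1] on [0, M], [f ^+ 2] and [p_n ^+ 2] differ there by at most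
   [d * (2 * Q + 3)] when [p_n] is within [d <= 1] of [f]. *)
pose W := C ^+ 2 * (2 * Q + 3) * `|u| ^+ 2.
have W0 : 0 <= W by rewrite !mulr_ge0 ?sqr_ge0// addr_ge0// mulr_ge0.
pose d := Num.min 1 (e / (W + 1)).
have d0 : 0 < d by rewrite lt_min ltr01 divr_gt0// ltr_wpDl.
have [N NP] := (uniform_cvgP _ _ _).1 (pf M) _ d0.
have Su := @fun_calc_norm_cvg u p pf.
have Su2 : C ^+ 2 * `|poly_op (p n) T u| ^+ 2 + e @[n --> \oo] -->
    C ^+ 2 * `|fun_calc f T u| ^+ 2 + e.
  by apply: cvgD; [apply: cvgMr; rewrite expr2; exact: cvgM|exact: cvg_cst].
apply: (cvgr_to_ge Su2); exists N => // n /= Nn.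
have Cn : C ^+ 2 * `|poly_op (p n) T u| ^+ 2 = `|poly_op (C *: p n) T u| ^+ 2.
  by rewrite poly_opZ normrZ exprMn (ger0_norm C0).
rewrite Cn.
apply: (@le_trans _ _ (`|poly_op (C *: p n) T u| ^+ 2 +
    C ^+ 2 * (d * (2 * Q + 3)) * `|u| ^+ 2)); last first.
  rewrite lerD2l [leLHS](_ : _ = d * W); last by rewrite /W; ring.
  apply: (@le_trans _ _ (e / (W + 1) * W)).
    by rewrite ler_wpM2r// ge_min lexx orbT.
  by rewrite mulrAC -mulrA ger_pMr// ler_pdivrMr ?mul1r ?lerDl// ltr_wpDl.
apply: (poly_op_norm_le hilb T_lin T_sym T_psd M_gt0 T_bound) => x xM.
have xM' : `[0, M]%classic x by rewrite /= in_itv.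
have f1 := N1P _ _ (leqnn N1) xM'; have fn := NP _ _ Nn xM'.
have pq := qQ _ xM; have qx := qf _ xM.
have fQ : `|f x| <= Q + 1.
  by rewrite -[f x](subrK (p N1).[x]) addrC (le_trans (ler_normD _ _))// lerD.
rewrite hornerZ exprMn -mulrDr -real_normK ?num_real//.
apply: (@le_trans _ _ ((C * `|f x|) ^+ 2)).
  by rewrite ler_sqr ?nnegrE ?mulr_ge0.
rewrite exprMn ler_wpM2l ?sqr_ge0// -(real_normK (num_real (p n).[x])).
have d1 : d <= 1 by rewrite ge_min lexx.
have fp : `|f x| <= `|(p n).[x]| + d.
  by rewrite -lerBlDl (le_trans (lerB_dist _ _)).
have a0 := normr_ge0 (f x); have b0 := normr_ge0 (p n).[x].
have pp : `|(p n).[x]| <= `|f x| + d.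
  by rewrite -lerBlDl (le_trans (lerB_dist _ _))// distrC.
move: fQ fp pp a0 b0 d1 d0 Q0; move: `|f x| `|(p n).[x]| => {}a {}b.
nra.
Qed.

End FunctionalCalculus.

(** * Residual polynomials *)

Section Residual.
Context {R : realType}.

Lemma bernoulli_le (Y : R) N : 0 <= Y <= 1 -> 1 - N%:R * Y <= (1 - Y) ^+ N.
Proof.
move=> /andP[Y0 Y1]; elim: N => [|N IH]; first by rewrite mul0r subr0 expr0.
rewrite exprSr -natr1; have N0 : 0 <= N%:R :> R by [].
have Y1' : 0 <= 1 - Y by rewrite subr_ge0.
have := ler_wpM2r Y1' IH; apply: le_trans.
nra.
Qed.

(** By induction, as [(1 - Y) * (1 + (N + 1) * Y) <= 1 + N * Y]. *)
Lemma bernoulli_decay (Y : R) N : 0 <= Y <= 1 ->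
  (1 - Y) ^+ N * (1 + N%:R * Y) <= 1.
Proof.
move=> /andP[Y0 Y1]; elim: N => [|N IH]; first by rewrite mul0r addr0 mul1r.
apply: le_trans IH; rewrite exprSr -mulrA ler_wpM2l ?exprn_ge0 ?subr_ge0//.
rewrite -natr1; have N0 : 0 <= N%:R :> R by [].
nra.
Qed.

(** With [min_le_powR], this trades the power [k], for which the bounds on the
    residual polynomial are elementary, for any real exponent up to [k]. *)
Lemma powR_le_1Dexpn (z s : R) k : 0 <= z -> 0 <= s <= k%:R ->
  z `^ s <= 1 + z ^+ k.
Proof.
move=> z0 /andP[s0 sk]; have zk : 0 <= z ^+ k by rewrite exprn_ge0.
have one_pow : (1 : R) `^ s = 1 by rewrite powR1.
have [z1|/ltW z1] := leP z 1.
  by rewrite ler_wpDr// -[leRHS]one_pow ge0_ler_powR ?nnegrE.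
by rewrite ler_wpDl// -powR_mulrn// ler_powR.
Qed.

Lemma min_le_powR (z s : R) k : 0 <= z -> 0 <= s <= k%:R ->
  Num.min 1 (z ^+ k) <= z `^ s.
Proof.
move=> z0 /andP[s0 sk]; have one_pow : (1 : R) `^ s = 1 by rewrite powR1.
rewrite ge_min; have [z1|/ltW z1] := leP z 1.
  have [->|zn0] := eqVneq z 0.
    have [k0|k0] := posnP k; last by rewrite expr0n gtn_eqF//= powR_ge0 orbT.
    have -> : s = 0 by apply/le_anti; rewrite s0 andbT (le_trans sk)// k0.
    by rewrite powRr0 lexx.
  apply/orP; right; rewrite -powR_mulrn// ger_powR// z1 andbT lt0r zn0//.
by apply/orP; left; rewrite -[leLHS]one_pow ge0_ler_powR ?nnegrE.
Qed.

Variables (k n : nat) (M : R).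
Hypotheses (M_gt0 : 0 < M).

(** Residual of [n ^ k] Landweber steps for ['X^k].  With [z = n * x / M] it lies
    between [1 - z ^+ k] and [1 / (1 + z ^+ k)], hence cuts off at [x] of order
    [M / n] for every [k]; the order [k] limits the powers of [x] whose decay it
    can see. *)
Definition residual : {poly R} := (1 - (M^-1 *: 'X) ^+ k) ^+ (n ^ k).

(** The quotient [(1 - residual) / 'X], written as a geometric sum. *)
Definition filter_quot : {poly R} :=
  M^-1 *: ((M^-1 *: 'X) ^+ k.-1 *
           \sum_(i < n ^ k) (1 - (M^-1 *: 'X) ^+ k) ^+ i).

Let z (x : R) := n%:R / M * x.

Let zk x : (n ^ k)%:R * (M^-1 * x) ^+ k = z x ^+ k.
Proof. by rewrite /z natrX -exprMn mulrA. Qed.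

Let Y01 x : 0 <= x <= M -> 0 <= (M^-1 * x) ^+ k <= 1.
Proof.
move=> /andP[x0 xM]; have y0 : 0 <= M^-1 * x by rewrite mulr_ge0// invr_ge0 ltW.
by rewrite exprn_ge0//= exprn_ile1// mulrC ler_pdivrMr ?mul1r.
Qed.

Let z_ge0 x : 0 <= x <= M -> 0 <= z x.
Proof. by move=> /andP[x0 _]; rewrite !mulr_ge0// invr_ge0 ltW. Qed.

Lemma residualE x : residual.[x] = (1 - (M^-1 * x) ^+ k) ^+ (n ^ k).
Proof. by rewrite /residual !(horner_exp, hornerE). Qed.

Lemma residual_itv x : 0 <= x <= M -> 0 <= residual.[x] <= 1.
Proof.
move=> /Y01/andP[Y0 Y1].
by rewrite residualE exprn_ge0 ?exprn_ile1 ?subr_ge0//= gerBl.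
Qed.

Lemma residual_decay (s x : R) : 0 <= s <= k%:R -> 0 <= x <= M ->
  (n%:R / M * x) `^ s * residual.[x] <= 1.
Proof.
move=> sk xM; have := bernoulli_decay (n ^ k) (Y01 xM).
rewrite zk -residualE mulrC; apply: le_trans.
have /andP[r0 _] := residual_itv xM.
by rewrite ler_wpM2r// powR_le_1Dexpn// z_ge0.
Qed.

Lemma one_sub_residual_le (s x : R) : 0 <= s <= k%:R -> 0 <= x <= M ->
  1 - residual.[x] <= (n%:R / M * x) `^ s.
Proof.
move=> sk xM; apply: le_trans (min_le_powR (z_ge0 xM) sk).
have /andP[r0 r1] := residual_itv xM.
rewrite le_min gerBl r0/= lerBlDr -lerBlDl -zk residualE.
exact: bernoulli_le (Y01 xM).
Qed.

Lemma one_sub_residualE : (0 < k)%N -> 1 - residual = filter_quot * 'X.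
Proof.
move=> k0; rewrite /residual /filter_quot -opprB subrX1.
rewrite addrAC subrr add0r mulNr opprK -{1}(prednK k0) exprS.
rewrite -!scalerAl; congr (_ *: _).
by rewrite -mulrA mulrC.
Qed.

(** For [x != 0] this is [one_sub_residual_le] with exponent 1 divided by [x]; at
    [x = 0] the quotient vanishes because [k > 1]. *)
Lemma filter_quot_bound x : (1 < k)%N -> 0 <= x <= M ->
  `|filter_quot.[x]| <= n%:R / M.
Proof.
move=> k1 xM; have /andP[x0 x1] := xM.
have [->|xn0] := eqVneq x 0.
  rewrite /filter_quot hornerZ hornerM horner_exp hornerZ hornerX mulr0.
  rewrite expr0n (_ : (k.-1 == 0)%N = false); last by lia.
  by rewrite mul0r mulr0 normr0 divr_ge0// ltW.
have xp : 0 < x by rewrite lt0r xn0.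
have /andP[r0 r1] := residual_itv xM.
have k0 : (0 < k)%N by lia.
have E : 1 - residual.[x] = filter_quot.[x] * x.
  by rewrite -[X in _ * X]hornerX -hornerM -one_sub_residualE// !hornerE.
have -> : filter_quot.[x] = (1 - residual.[x]) / x by rewrite E mulfK.
rewrite ger0_norm ?divr_ge0 ?subr_ge0// ler_pdivrMr//.
have := @one_sub_residual_le 1 x; rewrite powRr1 ?z_ge0//; apply => //.
by rewrite ler01 ler1n.
Qed.

End Residual.

(** * Invertibility of an operator that is bounded below *)

Section InverseOperator.
Context {R : realType} {X : completeNormedModType R} (ip : {dot X for idfun}).
Hypothesis hilb : hilbert_norm ip.

(** The projection theorem: by the parallelogram identity a sequence of [K] that
    minimizes the distance to [w] is Cauchy, and the difference between [w] and
    its limit is orthogonal to [K]. *)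
Lemma ortho_closed_full (K : set X) : K 0 ->
  (forall (k : R) u v, K u -> K v -> K (k *: u + v)) ->
  (forall (x : nat -> X) l, (forall n, K (x n)) -> x n @[n --> \oo] --> l -> K l) ->
  (forall v, (forall u, K u -> ip u v = 0) -> v = 0) ->
  forall w, K w.
Proof.
move=> K0 Klin Kcl Kort w.
pose S := [set `|w - k| | k in K].
have S0 : S !=set0 by exists `|w - 0|, 0.
have Slb : has_lbound S by exists 0 => _ [k _ <-].
have hS : has_inf S by [].
pose d := inf S.
have dle k : K k -> d <= `|w - k| by move=> Kk; apply: ge_inf => //; exists k.
have d0 : 0 <= d by apply: lb_le_inf => // _ [k _ <-].
have /choice[x xP] : forall n : nat, exists k, K k /\ `|w - k| < d + n.+1%:R^-1.
  move=> n; have [|_ [k Kk <-] h] := @inf_adherent _ S n.+1%:R^-1 _ hS.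
    by rewrite invr_gt0.
  by exists k.
have midK u v : K u -> K v -> K (2^-1 *: (u + v)).
  move=> Ku Kv; rewrite -[X in K X]addr0; apply: (Klin) => //.
  by rewrite -[u]scale1r; apply: (Klin).
have par u v : K u -> K v ->
    `|u - v| ^+ 2 <= 2 * `|w - u| ^+ 2 + 2 * `|w - v| ^+ 2 - 4 * d ^+ 2.
  move=> Ku Kv; rewrite lerBrDr -(ip_parallelogram hilb).
  have -> : w - u - (w - v) = - (u - v).
    by rewrite opprB addrC addrA subrK opprB.
  rewrite normrN addrC lerD2r.
  have -> : w - u + (w - v) = 2 *: (w - 2^-1 *: (u + v)).
    by rewrite scalerBr scalerA mulfV// scale1r scaler_nat mulr2n opprD addrACA.
  rewrite normrZ exprMn normr_nat (_ : 2 ^+ 2 = 4 :> R); last by ring.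
  by rewrite ler_pM2l// ler_sqr ?nnegrE// dle//; exact: midK.
have [k xk] : exists k : X, x n @[n --> \oo] --> k.
  apply: cauchy_norm_cvg => e e0.
  pose t := Num.min 1 (e ^+ 2 / (4 * (2 * d + 1))).
  have t0 : 0 < t.
    by rewrite lt_min ltr01 divr_gt0 ?exprn_gt0// mulr_gt0// ltr_wpDl// mulr_ge0.
  pose N := Num.bound (t^-1).
  have NP i : (N <= i)%N -> `|w - x i| <= d + t.
    move=> Ni; apply: (le_trans (ltW (xP i).2)); rewrite lerD2l.
    rewrite -[t]invrK lef_pV2 ?posrE ?invr_gt0//.
    have tV : 0 <= t^-1 by rewrite invr_ge0 ltW.
    by rewrite (le_trans (ltW (archi_boundP tV)))// ler_nat -/N; lia.
  exists N => i j Ni Nj.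
  rewrite -ler_sqr ?nnegrE// ?(ltW e0)//.
  apply: (le_trans (par _ _ (xP i).1 (xP j).1)).
  have t1 : t <= 1 by rewrite ge_min lexx.
  have te : t * (4 * (2 * d + 1)) <= e ^+ 2.
    rewrite -ler_pdivlMr ?ge_min ?lexx ?orbT//.
    by rewrite mulr_gt0// ltr_wpDl// mulr_ge0.
  have hi : `|w - x i| ^+ 2 <= (d + t) ^+ 2.
    by rewrite ler_sqr ?nnegrE ?NP// addr_ge0// ltW.
  have hj : `|w - x j| ^+ 2 <= (d + t) ^+ 2.
    by rewrite ler_sqr ?nnegrE ?NP// addr_ge0// ltW.
  apply: (le_trans _ te).
  apply: (@le_trans _ _ (2 * (d + t) ^+ 2 + 2 * (d + t) ^+ 2 - 4 * d ^+ 2)).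
    by rewrite lerD2r lerD// ler_pM2l.
  have -> : 2 * (d + t) ^+ 2 + 2 * (d + t) ^+ 2 - 4 * d ^+ 2 =
      t * (4 * (2 * d + t)) by ring.
  by rewrite ler_wpM2l ?(ltW t0)// ler_pM2l// lerD2l.
have Kk : K k by apply: Kcl xk => n; exact: (xP n).1.
have wkd : `|w - k| <= d.
  apply/ler_addgt0Pr => e e0.
  have h : `|w - x n| @[n --> \oo] --> `|w - k|.
    by apply: cvg_norm; apply: cvgB => //; exact: cvg_cst.
  apply: (cvgr_to_le h); exists (Num.bound (e^-1)) => // n /= Nn.
  apply: (le_trans (ltW (xP n).2)); rewrite lerD2l.
  rewrite -[e]invrK lef_pV2 ?posrE ?invr_gt0//.
  have eV : 0 <= e^-1 by rewrite invr_ge0 ltW.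
  by rewrite (le_trans (ltW (archi_boundP eV)))// ler_nat; lia.
suff : w - k = 0 by move/eqP; rewrite subr_eq0 => /eqP ->.
apply: Kort => h Kh; rewrite ipC.
set r := w - k in wkd *; set c := ip r h.
have opt (t : R) : 0 <= - 2 * t * c + t ^+ 2 * `|h| ^+ 2.
  have : d <= `|r + (- t) *: h|.
    have -> : r + (- t) *: h = w - (t *: h + k).
      by rewrite /r opprD scaleNr addrA [LHS]addrAC.
    by apply: dle; apply: (Klin).
  rewrite -ler_sqr ?nnegrE// (ip_normD hilb) ipZr normrZ exprMn normrN.
  rewrite real_normK ?num_real// -/c => hd.
  have rd : `|r| ^+ 2 <= d ^+ 2 by rewrite ler_sqr ?nnegrE.
  have := le_trans rd hd; rewrite -addrA lerDl.
  by congr (_ <= _); ring.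
(* The best step is [c / `|h| ^+ 2]; the 1 added to the denominator covers [h = 0]
   and still leaves a negative multiple of [c ^+ 2]. *)
have := opt (c / (`|h| ^+ 2 + 1)).
have H0 : 0 <= `|h| ^+ 2 by rewrite sqr_ge0.
move: H0; move: (`|h| ^+ 2) => H H0.
rewrite (_ : _ + _ = - (c ^+ 2 * ((H + 2) / (H + 1) ^+ 2))); last first.
  by field; rewrite gt_eqF// ltr_wpDl.
rewrite oppr_ge0 pmulr_lle0; last by rewrite divr_gt0 ?exprn_gt0// ltr_wpDl.
by rewrite real_exprn_even_le0 ?num_real//= => /eqP.
Qed.

Context (DB : set X) (B : X -> X) (m : R).
Hypotheses (B_lin : linear_on DB B) (B_sa : selfadjoint ip DB B).
Hypotheses (B_pos : positive_definite ip DB B) (m_gt0 : 0 < m).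
Hypothesis B_below : forall u : X, DB u -> m * `|u| <= `|B u|.

Lemma domain0 : DB 0.
Proof. by case: B_lin. Qed.

Lemma domain_lin (k : R) u v : DB u -> DB v -> DB (k *: u + v).
Proof. by move=> Du Dv; case: (B_lin.2 k u v Du Dv). Qed.

Lemma operator_lin (k : R) u v : DB u -> DB v -> B (k *: u + v) = k *: B u + B v.
Proof. by move=> Du Dv; case: (B_lin.2 k u v Du Dv). Qed.

Lemma domainB u v : DB u -> DB v -> DB (u - v).
Proof. by move=> Du Dv; rewrite addrC -scaleN1r; exact: domain_lin. Qed.

Lemma domainD u v : DB u -> DB v -> DB (u + v).
Proof. by move=> Du Dv; rewrite -[u]scale1r; exact: domain_lin. Qed.

Lemma operatorB u v : DB u -> DB v -> B (u - v) = B u - B v.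
Proof.
by move=> Du Dv; rewrite addrC -scaleN1r operator_lin// scaleN1r addrC.
Qed.

Lemma operator_inj : {in DB &, injective B}.
Proof.
move=> u v /set_mem Du /set_mem Dv E.
have := B_below (domainB Du Dv); rewrite operatorB// E subrr normr0.
by rewrite pmulr_rle0// normr_le0 subr_eq0 => /eqP.
Qed.

Lemma operator_sym u v : DB u -> DB v -> ip (B u) v = ip u (B v).
Proof. by move=> Du Dv; have [+ _] := B_sa v (B v); apply. Qed.

(** The range is closed, since [B] is bounded below and has the closed graph of an
    adjoint.  A vector orthogonal to the range belongs to the kernel of the
    adjoint, which is [B] itself and is injective. *)
Lemma operator_surj w : exists2 u, DB u & B u = w.
Proof.
apply: (@ortho_closed_full [set w | exists2 u, DB u & B u = w]).
- exists 0; first exact: domain0.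
  have := operator_lin (-1) domain0 domain0.
  by rewrite scaler0 addr0 scaleN1r addNr.
- move=> k _ _ [u Du <-] [v Dv <-]; exists (k *: u + v); first exact: domain_lin.
  exact: operator_lin.
- move=> x l xK xl.
  have /choice[y yP] : forall n, exists u, DB u /\ B u = x n.
    by move=> n; have [u] := xK n; exists u.
  have [y' yy'] : exists y' : X, y n @[n --> \oo] --> y'.
    apply: cauchy_norm_cvg => e e0.
    move/cvgrPdist_le: xl => /(_ (m * e / 2)) []; first by rewrite !mulr_gt0.
    move=> N _ NP; exists N => i j Ni Nj.
    rewrite -(ler_pM2l m_gt0); apply: (le_trans (B_below (domainB (yP i).1 (yP j).1))).
    rewrite operatorB; [|exact: (yP i).1|exact: (yP j).1].
    rewrite (yP i).2 (yP j).2 [leRHS]splitr -(subrKA l).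
    by rewrite (le_trans (ler_normD _ _))// lerD// ?NP// distrC NP.
  have [] := (B_sa y' l).2; last by exists y'.
  move=> u Du; rewrite (ipC ip _ y') (ipC ip u).
  have h1 : ip (y n) (B u) @[n --> \oo] --> ip y' (B u) by exact: ip_cvgl.
  have h2 : ip (x n) u @[n --> \oo] --> ip l u by exact: ip_cvgl.
  apply: (cvg_unique _ h1) => //=.
  rewrite (_ : (fun n => _) = (fun n => ip (x n) u))//.
  by apply/funext => n; have [Dy <-] := yP n; rewrite operator_sym.
- move=> v vort.
  have [Dv Bv] : DB v /\ B v = 0.
    apply/B_sa => u Du; rewrite [RHS]ipC ip0l; apply: vort; by exists u.
  have := B_below Dv; rewrite Bv normr0 pmulr_rle0// normr_le0 => /eqP->.
  by [].
Qed.

Local Notation T := ('pinv_(fun=> 0) DB B).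

Lemma inverseK w : B (T w) = w.
Proof.
have [u Du Bu] := operator_surj w.
by apply: pinvK; apply/mem_set; exists u.
Qed.

Lemma inverse_dom w : DB (T w).
Proof.
have E := @injpinv_image _ _ (fun=> 0) DB B operator_inj.
rewrite -[X in X (T w)]E; exists w => //.
by have [u Du Bu] := operator_surj w; exists u.
Qed.

Lemma operatorK u : DB u -> T (B u) = u.
Proof. by move=> Du; rewrite (@pinvKV _ _ (fun=> 0) DB B operator_inj) ?inE. Qed.

Lemma inverse_linear : linear T.
Proof.
move=> k u v; rewrite -[X in T X](_ : B (k *: T u + T v) = _).
  by rewrite operatorK//; apply: domain_lin; exact: inverse_dom.
by rewrite operator_lin ?inverseK//; exact: inverse_dom.
Qed.

Lemma inverse_sym u v : ip (T u) v = ip u (T v).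
Proof.
by rewrite -{1}(inverseK v) -operator_sym ?inverseK//; exact: inverse_dom.
Qed.

Lemma inverse_psd u : 0 <= ip (T u) u.
Proof.
have [->|Tu0] := eqVneq (T u) 0; first by rewrite ip0l.
rewrite ipC -{1}(inverseK u); apply/ltW/B_pos => //; exact: inverse_dom.
Qed.

Lemma inverse_bound u : `|T u| <= m^-1 * `|u|.
Proof.
rewrite mulrC ler_pdivlMr// mulrC -{2}(inverseK u).
by apply: B_below; exact: inverse_dom.
Qed.

End InverseOperator.

(** * Filters and the negative norm *)

Section FilterBounds.
Context {R : realType} {X : completeNormedModType R} (ip : {dot X for idfun}).
Hypothesis hilb : hilbert_norm ip.
Context (T : X -> X) (M a : R) (k : nat).
Hypotheses (T_lin : linear T) (T_sym : forall u v, ip (T u) v = ip u (T v)).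
Hypotheses (T_psd : forall u, 0 <= ip (T u) u).
Hypotheses (M_gt0 : 0 < M) (T_bound : forall u, `|T u| <= M * `|u|).
Hypotheses (a_gt0 : 0 < a) (k_gt1 : (1 < k)%N) (k_ge : a + 1 <= k%:R).
Implicit Types (u v w y : X) (n : nat).

Local Notation S := (fun_calc (fun x => x `^ a) T).
Local Notation rT n := (poly_op (residual k n M) T).
Local Notation qT n := (poly_op (filter_quot k n M) T).

Let approx := powR_poly_approx a_gt0.
Let bound := poly_op_norm_bound hilb T_lin T_sym T_psd M_gt0 T_bound.
Let S_bound := fun_calc_poly_op_bound hilb T_lin T_sym T_psd M_gt0 T_bound approx.
Let le_S := poly_op_le_fun_calc hilb T_lin T_sym T_psd M_gt0 T_bound approx.

Let a_itv : 0 <= a <= k%:R.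
Proof. by rewrite ltW//= (le_trans _ k_ge)// lerDl. Qed.
Let one_itv : 0 <= (1 : R) <= k%:R.
Proof. by rewrite ler01 ler1n ltnW. Qed.
Let a1_itv : 0 <= a + 1 <= k%:R.
Proof. by rewrite k_ge andbT addr_ge0// ltW. Qed.

Lemma residual_contr n u : `|rT n u| <= `|u|.
Proof.
rewrite -[leRHS]mul1r; apply: bound => // x xM.
by have /andP[r0 r1] := residual_itv k n M_gt0 xM; rewrite ger0_norm.
Qed.

Lemma powR_residual_le s n x : (0 < n)%N -> 0 <= s <= k%:R -> 0 <= x <= M ->
  `|x `^ s * (residual k n M).[x]| <= (M / n%:R) `^ s.
Proof.
move=> n0 sk xM; have /andP[r0 r1] := residual_itv k n M_gt0 xM.
have nR : 0 < n%:R :> R by rewrite ltr0n.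
have /andP[x0 _] := xM.
have nM : 0 < n%:R / M by rewrite divr_gt0.
rewrite ger0_norm ?mulr_ge0 ?powR_ge0//.
have -> : M / n%:R = (n%:R / M)^-1 by rewrite invf_div.
rewrite -powR_inv1 ?(ltW nM)// -powRrM mulN1r powRN -[leRHS]mul1r.
rewrite ler_pdivlMr ?powR_gt0// mulrC mulrA -powRM ?(ltW nM)//.
exact: residual_decay.
Qed.

Lemma residual_range n y : (0 < n)%N -> `|rT n (T y)| <= M / n%:R * `|y|.
Proof.
move=> n0; rewrite -poly_opMX; apply: bound; first by rewrite divr_ge0// ltW.
move=> x xM; rewrite hornerM hornerX mulrC.
have /andP[x0 _] := xM.
have := powR_residual_le n0 one_itv xM.
by rewrite !powRr1 ?divr_ge0// ltW.
Qed.

Lemma neg_norm_residual n u : (0 < n)%N -> `|S (rT n u)| <= (M / n%:R) `^ a * `|u|.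
Proof.
move=> n0; apply: S_bound => [|x xM]; first exact: powR_ge0.
exact: powR_residual_le.
Qed.

Lemma neg_norm_residual_range n y : (0 < n)%N ->
  `|S (rT n (T y))| <= (M / n%:R) `^ (a + 1) * `|y|.
Proof.
move=> n0; rewrite -poly_opMX; apply: S_bound => [|x xM]; first exact: powR_ge0.
rewrite hornerM hornerX mulrCA mulrC.
have /andP[x0 _] := xM.
have := powR_residual_le n0 a1_itv xM.
rewrite powRD ?powRr1//; last by rewrite gt_eqF// addr_gt0.
Qed.

(** The part that the filter keeps is controlled by the negative norm.  Together
    with [residual_range] for the part that it removes, this is an interpolation
    inequality in which [n] is still free. *)
Lemma filter_le_neg_norm n u : `|u - rT n u| <= (n%:R / M) `^ a * `|S u|.
Proof.
have -> : u - rT n u = poly_op (1 - residual k n M) T u.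
  by rewrite poly_opB (poly_opC _ 1) scale1r.
apply: le_S => [|x xM]; first exact: powR_ge0.
have /andP[r0 r1] := residual_itv k n M_gt0 xM; have /andP[x0 _] := xM.
rewrite hornerD hornerN hornerC ger0_norm ?subr_ge0//.
rewrite (ger0_norm (powR_ge0 _ _)) -powRM ?divr_ge0// ?(ltW M_gt0)//.
exact: one_sub_residual_le.
Qed.

Lemma filter_quot_range n w : T (qT n w) = w - rT n w.
Proof.
rewrite -[X in X - _]scale1r -(poly_opC T 1) -poly_opB.
rewrite one_sub_residualE 1?ltnW// mulrC poly_opM// poly_opX//.
Qed.

Lemma filter_quot_norm n u : `|qT n u| <= n%:R / M * `|u|.
Proof.
apply: bound => [|x xM]; first by rewrite divr_ge0// ltW.
exact: filter_quot_bound.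
Qed.

Lemma filter_quot_contr n y : `|qT n (T y)| <= `|y|.
Proof.
rewrite -poly_opMX -one_sub_residualE 1?ltnW// -[leRHS]mul1r.
apply: bound => // x xM; rewrite hornerD hornerN hornerC.
have /andP[r0 r1] := residual_itv k n M_gt0 xM.
by rewrite ger0_norm ?subr_ge0// gerBl.
Qed.

(** Each of the three quantities is bounded by a constant times the norm of [w],
    and is [O(1 / n)] when [w] is in the range of [T]; approximating [w] by such
    elements gives convergence to 0. *)
Lemma residual_vanish w (e : R) : 0 < e ->
  (forall d : R, 0 < d -> exists y, `|w - T y| <= d) ->
  exists N, forall n, (N <= n)%N ->
    [/\ (0 < n)%N, `|rT n w| <= e, n%:R `^ a * `|S (rT n w)| <= e &
        `|qT n w| <= e * n%:R].
Proof.
move=> e0 dens.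
pose K := 1 + M `^ a + M^-1; pose K' := M + M `^ a * M + 1.
have Ma0 : 0 < M `^ a by exact: powR_gt0.
have MV0 : 0 < M^-1 by rewrite invr_gt0.
have K0 : 0 < K by rewrite !addr_gt0.
have K'0 : 0 < K' by rewrite !addr_gt0// mulr_gt0.
have d0 : 0 < e / 2 / K by rewrite !divr_gt0.
have [y hy] := dens _ d0.
pose t := K' * `|y| / (e / 2); have t0 : 0 <= t.
  by rewrite divr_ge0 ?mulr_ge0 ?(ltW K'0)// ltW.
exists (Num.bound t).+1 => n Nn.
have n0 : (0 < n)%N by exact: leq_trans Nn.
have nR : 0 < n%:R :> R by rewrite ltr0n.
have tn : K' * `|y| / n%:R <= e / 2.
  rewrite ler_pdivrMr// -ler_pdivrMl ?divr_gt0// mulrC -/t.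
  by rewrite (le_trans (ltW (archi_boundP t0)))// ler_nat ltnW.
have wE : w = (w - T y) + T y by rewrite subrK.
have Kd : K * `|w - T y| <= e / 2 by rewrite mulrC -ler_pdivlMr.
have key (c c' : R) x : c <= K -> c' <= K' ->
    x <= c * `|w - T y| + c' * `|y| / n%:R -> x <= e.
  move=> cK cK' /le_trans; apply; rewrite [leRHS]splitr lerD//.
    by rewrite (le_trans _ Kd)// ler_wpM2r.
  by rewrite (le_trans _ tn)// ler_wpM2r ?invr_ge0 ?(ltW nR)// ler_wpM2r.
split=> //.
- apply: (key 1 M); first by rewrite /K -addrA lerDl addr_ge0// ltW.
    by rewrite /K' -addrA lerDl addr_ge0// mulr_ge0 ?(ltW Ma0)// ltW.
  rewrite {1}wE poly_op_add// (le_trans (ler_normD _ _))// mul1r mulrAC.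
  by rewrite lerD ?residual_contr ?residual_range.
- apply: (key (M `^ a) (M `^ a * M)).
  + by rewrite /K addrAC lerDr addr_ge0// ltW.
  + by rewrite /K' addrAC lerDr addr_ge0// ltW.
  have na0 : 0 <= n%:R `^ a :> R by exact: powR_ge0.
  have E : n%:R `^ a * (M / n%:R) `^ a = M `^ a.
    by rewrite -powRM ?divr_ge0 ?(ltW M_gt0)// mulrC divfK ?gt_eqF.
  have SD := fun_calc_linear hilb T_lin T_sym T_psd M_gt0 T_bound approx.
  rewrite {1}wE poly_op_add// -[rT n (w - _)]scale1r SD scale1r.
  apply: (@le_trans _ _ (n%:R `^ a * ((M / n%:R) `^ a * `|w - T y| +
      (M / n%:R) `^ (a + 1) * `|y|))).
    rewrite ler_wpM2l// (le_trans (ler_normD _ _))//.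
    by rewrite lerD ?neg_norm_residual ?neg_norm_residual_range.
  rewrite powRD ?powRr1 ?divr_ge0 ?(ltW M_gt0)//; last first.
    by rewrite gt_eqF// addr_gt0.
  rewrite mulrDr !mulrA E lerD2l.
  by rewrite [leRHS]mulrAC.
- rewrite -ler_pdivrMr//; apply: (key M^-1 1).
  + by rewrite /K lerDr addr_ge0// ltW.
  + by rewrite /K' lerDr addr_ge0// ?mulr_ge0 ?(ltW Ma0)// ltW.
  rewrite ler_pdivrMr// mul1r mulrDl divfK ?gt_eqF//.
  rewrite {1}wE poly_op_add// (le_trans (ler_normD _ _))//.
  rewrite lerD ?filter_quot_contr//.
  by rewrite mulrAC [M^-1 * _]mulrC filter_quot_norm.
Qed.

End FilterBounds.

(** * Approximation in the Hilbert scale *)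

Section HilbertScale.
Context {R : realType} {X : completeNormedModType R} (ip : {dot X for idfun}).
Hypothesis hilb : hilbert_norm ip.
Context (DB : set X) (B : X -> X) (m : R).
Hypotheses (B_lin : linear_on DB B) (B_sa : selfadjoint ip DB B).
Hypotheses (B_dense : dense DB).
Hypotheses (B_pos : positive_definite ip DB B) (m_gt0 : 0 < m).
Hypothesis B_below : forall u : X, DB u -> m * `|u| <= `|B u|.
Context (a : R) (a_gt0 : 0 < a).

(** The approximant is [v = udag + r(T) (ubar - udag)] for a residual polynomial
    [r]; its distance [v - ubar] to the initial guess is in the range of the
    inverse of [B].  The error bound for [x] splits [x - udag] into
    [(1 - r)(T) (x - udag)], [r(T) (x - ubar)] and [r(T) (ubar - udag)]. *)
Lemma hilbert_scale_approx (udag ubar : X) :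
  exists2 K : R, 0 < K & forall e : R, 0 < e -> exists N, forall n, (N <= n)%N ->
  [/\ (0 < n)%N,
    exists v, [/\ DB (v - ubar), `|v - udag| <= e,
      n%:R `^ a * norm_neg DB B a (v - udag) <= e & `|B (v - ubar)| <= e * n%:R] &
    forall x, DB (x - ubar) -> `|x - udag| <=
      K * (n%:R `^ a * norm_neg DB B a (x - udag) + `|B (x - ubar)| / n%:R) + e].
Proof.
pose T := 'pinv_(fun=> 0) DB B; pose M := m^-1.
have M0 : 0 < M by rewrite invr_gt0.
have T_lin : linear T by exact: (inverse_linear hilb B_lin B_sa m_gt0 B_below).
have T_sym u v : ip (T u) v = ip u (T v) by exact: (inverse_sym hilb B_lin B_sa m_gt0 B_below).
have T_psd u : 0 <= ip (T u) u by exact: (inverse_psd hilb B_lin B_sa B_pos m_gt0 B_below).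
have T_bound u : `|T u| <= M * `|u| by exact: (inverse_bound hilb B_lin B_sa m_gt0 B_below).
have DT u : DB (T u) by exact: (inverse_dom hilb B_lin B_sa m_gt0 B_below).
have BT u : B (T u) = u by exact: (inverseK hilb B_lin B_sa m_gt0 B_below).
have TB u : DB u -> T (B u) = u by exact: (operatorK B_lin m_gt0 B_below).
(* The order must exceed 1 and reach the exponent [a + 1]. *)
pose k := (Num.bound (a + 1)).+2.
have k1 : (1 < k)%N by [].
have ka : a + 1 <= k%:R.
  have a10 : 0 <= a + 1 by rewrite addr_ge0// ltW.
  by rewrite (le_trans (ltW (archi_boundP a10)))// ler_nat /k ltnW// ltnW.
have a1_gt0 : 0 < M^-1 `^ a by rewrite powR_gt0 ?invr_gt0.
exists (M^-1 `^ a + M) => [|e e0]; first by rewrite addr_gt0.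
have [|N NP] := residual_vanish hilb T_lin T_sym T_psd M0 T_bound a_gt0 k1 ka
    (w := ubar - udag) e0.
  move=> d d0; have [|z [zb Dz]] := B_dense _ (ball_open (ubar - udag) d).
    by exists (ubar - udag); apply: ballxx.
  exists (B z); rewrite TB//; move: zb; rewrite -ball_normE/=; exact: ltW.
exists N => n Nn; have [n0 rw Srw qw] := NP _ Nn.
have nR : 0 < n%:R :> R by rewrite ltr0n.
have Tq := filter_quot_range M T_lin k1 n (ubar - udag).
set w := ubar - udag in rw Srw qw Tq *.
set r := poly_op (residual k n M) T in rw Srw Tq.
split=> //.
  exists (udag + r w); rewrite (_ : udag + r w - udag = r w); last by rewrite addrC addKr.
  have E : udag + r w - ubar = T (- poly_op (filter_quot k n M) T w).
    have -> : - poly_op (filter_quot k n M) T w =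
        (-1) *: poly_op (filter_quot k n M) T w + 0 by rewrite scaleN1r addr0.
    have T0 : T 0 = 0.
      by have := T_lin (-1) 0 0; rewrite scaler0 addr0 scaleN1r addNr.
    by rewrite T_lin T0 addr0 scaleN1r Tq opprB /w opprB addrAC addrA addrC addrA.
  split=> //; first by rewrite E.
  by rewrite E BT normrN.
move=> x Dx.
have xE : x - udag = (x - udag - r (x - udag)) + r (x - ubar) + r w.
  by rewrite -addrA -poly_op_add// subrKA subrK.
rewrite [X in `|X|]xE.
rewrite (le_trans (ler_normD _ _))// lerD// (le_trans (ler_normD _ _))//.
have nM : 0 <= n%:R / M by rewrite divr_ge0 ?ltW.
have na0 : 0 <= n%:R `^ a * norm_neg DB B a (x - udag).
  by rewrite mulr_ge0 ?powR_ge0// /norm_neg.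
have nB0 : 0 <= `|B (x - ubar)| / n%:R by rewrite divr_ge0// ltW.
apply: (@le_trans _ _ (M^-1 `^ a * (n%:R `^ a * norm_neg DB B a (x - udag)) +
    M * (`|B (x - ubar)| / n%:R))); last first.
  rewrite mulrDl !mulrDr -!addrA lerD2l addrA lerDr.
  by rewrite addr_ge0// mulr_ge0// ltW.
rewrite lerD//.
  have := filter_le_neg_norm hilb T_lin T_sym T_psd M0 T_bound a_gt0 ka n (x - udag).
  rewrite powRM//; last by rewrite invr_ge0 ltW.
  by move=> /le_trans; apply; rewrite mulrAC mulrC; exact: lexx.
have := residual_range hilb T_lin T_sym T_psd M0 T_bound k1 (B (x - ubar)) n0.
by rewrite TB// mulrAC -mulrA.
Qed.

End HilbertScale.

(** * The scale of the regularization parameter *)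

Section ParameterScale.
Context {R : realType} (a : R) (a_gt0 : 0 < a).

(** This is [h `^ (2 * a + 2)].  As a product it shows the two contributions to the
    Tikhonov functional: an element at distance [h `^ a] in the negative norm and
    of size [h^-1] after [B] makes both of order [h `^ a ^+ 2]. *)
Definition penalty_of_scale (h : R) : R := (h `^ a) ^+ 2 * h ^+ 2.

Lemma penalty_of_scaleP (alpha : R) : 0 < alpha ->
  exists2 h : R, 0 < h & [/\ h = alpha `^ (2 * a + 2)^-1, penalty_of_scale h = alpha &
    alpha `^ (a / (2 * a + 2)) = h `^ a].
Proof.
move=> al0; exists (alpha `^ (2 * a + 2)^-1); first exact: powR_gt0.
have q0 : 2 * a + 2 != 0 by rewrite gt_eqF// addr_gt0// mulr_gt0.
set h := alpha `^ _; have h0 : 0 < h by exact: powR_gt0.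
split=> //; last by rewrite /h -powRrM mulrC.
rewrite /penalty_of_scale -!powR_mulrn ?powR_ge0//.
rewrite -powRrM -powRD; last by rewrite (gt_eqF h0) implybT.
by rewrite mulrC /h -powRrM mulVf// powRr1// ltW.
Qed.

(** The index [n] of the residual polynomial plays the role of [1 / h]. *)
Lemma index_of_scale (N : nat) : exists2 h0 : R, 0 < h0 & forall h : R, 0 < h <= h0 ->
  exists2 n, (N <= n)%N & n%:R * h <= 1 <= 2 * n%:R * h.
Proof.
exists (N.+1%:R)^-1 => [|h /andP[h0 hh]]; first by rewrite invr_gt0.
have Nh : N.+1%:R <= h^-1 by rewrite -[N.+1%:R]invrK lef_pV2 ?posrE ?invr_gt0.
have hV : 0 <= h^-1 by rewrite invr_ge0 ltW.
have /andP[t1 t2] := truncn_itv hV.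
exists (Num.truncn h^-1).
  by rewrite -ltnS -(ltr_nat R) (lt_trans _ t2)// (lt_le_trans _ Nh)// ltr_nat.
set n := Num.truncn h^-1 in t1 t2 *.
have n1 : (1 : R) <= n%:R.
  rewrite ler1n -ltnS -(ltr_nat R) (le_lt_trans _ t2)// (le_trans _ Nh)//.
  by rewrite ler1n.
apply/andP; split; first by rewrite -ler_pdivlMr// mul1r.
rewrite -ler_pdivrMr// mul1r (le_trans (ltW t2))// -natr1 mulr_natl mulr2n.
by rewrite lerD2l.
Qed.

End ParameterScale.

(** * Tikhonov minimizers *)

Section Tikhonov.
Context {R : realType} {X Y : completeNormedModType R}.
Context (DB DF : set X) (B : X -> X) (F : X -> Y) (ubar udag : X) (fdag : Y).
Context (a b ca Ca K : R) (N : X -> R).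
Hypotheses (DB_add : forall u v, DB u -> DB v -> DB (u + v)) (DBubar : DB ubar).
Hypothesis udag_int : (interior DF) udag.
Hypotheses (a_gt0 : 0 < a) (b_gt1 : 1 < b) (ca_gt0 : 0 < ca) (Ca_ge0 : 0 <= Ca).
Hypothesis F_cond : forall u, DF u -> DB u ->
  ca * N (u - udag) <= `|F u - fdag| <= Ca * N (u - udag).
Hypothesis K_gt0 : 0 < K.
Hypothesis approx : forall e : R, 0 < e -> exists n0, forall n, (n0 <= n)%N ->
  [/\ (0 < n)%N,
    exists v, [/\ DB (v - ubar), `|v - udag| <= e,
      n%:R `^ a * N (v - udag) <= e & `|B (v - ubar)| <= e * n%:R] &
    forall x, DB (x - ubar) -> `|x - udag| <=
      K * (n%:R `^ a * N (x - udag) + `|B (x - ubar)| / n%:R) + e].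

Local Notation J := (tikhonov DB B F ubar).

(** The finite value at the competitor [v] forces [u - ubar] into the domain of
    [B]. *)
Lemma minimizer_le fd (alpha : R) u v : 0 < alpha -> minimizer DF (J fd alpha) u ->
  DF v -> DB (v - ubar) ->
  [/\ DF u, DB (u - ubar) & `|F u - fd| ^+ 2 + alpha * `|B (u - ubar)| ^+ 2 <=
    `|F v - fd| ^+ 2 + alpha * `|B (v - ubar)| ^+ 2].
Proof.
move=> al0 [DFu umin] DFv Dv; have := umin v DFv.
rewrite /tikhonov /norm_one (mem_set Dv).
case: ifPn => [/set_mem Du|_].
  by rewrite -!EFin_expe -!EFinM -!EFinD lee_fin.
rewrite -[(+oo ^+ 2)%E]/(+oo * +oo)%E mulyy gt0_muley ?lte_fin//.
Qed.

Lemma domain_shift u : DB (u - ubar) -> DB u.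
Proof. by move=> Du; rewrite -[u](subrK ubar); exact: DB_add. Qed.

(** The competitor is the approximant [v] with index of order [1 / h]: the distance
    from [F v] to [fdag] and the square root of the penalty at [v] are both
    [o(h `^ a)], and [v] is in [DF] because [udag] is an interior point. *)
Lemma minimizer_bounds (e : R) : 0 < e -> exists2 h0 : R, 0 < h0 &
  forall (h delta : R) fd u, 0 < h <= h0 -> 0 < delta -> `|fd - fdag| <= delta ->
  minimizer DF (J fd (penalty_of_scale a h)) u ->
  [/\ DF u, DB (u - ubar), `|F u - fd| <= delta + e * h `^ a &
    h * h `^ a * `|B (u - ubar)| <= delta + e * h `^ a].
Proof.
move=> e0; have [rho/= rho0 rhoP] := (nbhs_ballP _ _).1 udag_int.
(* [Ca * 2 `^ a] stems from the data term, where [n^-1 <= 2 * h], and 1 from the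
   penalty. *)
pose C := Ca * 2 `^ a + 1.
have C0 : 0 < C by rewrite ltr_wpDl// mulr_ge0// powR_ge0.
pose e1 := Num.min (e / C) (rho / 2).
have e10 : 0 < e1 by rewrite lt_min !divr_gt0.
have [n0 n0P] := approx e10.
have [h0 h00 h0P] := index_of_scale (R := R) n0.
exists h0 => // h delta fd u hh d0 fdd umin; have /andP[hp _] := hh.
have [n nn0 /andP[nh1 nh2]] := h0P _ hh.
have [np [v [Dv vu Nv Bv]] _] := n0P _ nn0.
have nR : 0 < n%:R :> R by rewrite ltr0n.
have na0 : 0 < n%:R `^ a :> R by rewrite powR_gt0.
set g := h `^ a; have g0 : 0 < g by rewrite powR_gt0.
have ng : 1 <= 2 `^ a * n%:R `^ a * g.
  rewrite -!powRM ?mulr_ge0 ?(ltW hp)//.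
  by rewrite -[leLHS](powRr0 (2 * n%:R * h)) ler_powR// ltW.
have DFv : DF v.
  apply: rhoP; rewrite -ball_normE/= distrC (le_lt_trans vu)//.
  have rho2 : rho / 2 < rho by rewrite ltr_pdivrMr// ltr_pMr// ltr1n.
  by rewrite gt_min rho2 orbT.
have p0 : 0 < penalty_of_scale a h by rewrite mulr_gt0 ?exprn_gt0.
have [DFu Du le] := minimizer_le p0 umin DFv Dv.
have Fv : `|F v - fd| <= delta + Ca * 2 `^ a * e1 * g.
  rewrite -(subrKA fdag) (le_trans (ler_normD _ _))// addrC lerD//.
    by rewrite distrC.
  have /andP[_ +] := F_cond DFv (domain_shift Dv); move=> /le_trans; apply.
  rewrite -!mulrA ler_wpM2l//.
  have Ne : N (v - udag) <= e1 / n%:R `^ a by rewrite ler_pdivlMr// mulrC.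
  apply: (le_trans Ne); rewrite ler_pdivrMr//.
  rewrite [leRHS](_ : _ = e1 * (2 `^ a * n%:R `^ a * g)); last by ring.
  by rewrite ler_peMr// ltW.
have Bv' : penalty_of_scale a h * `|B (v - ubar)| ^+ 2 <= (e1 * g) ^+ 2.
  rewrite /penalty_of_scale -/g -!exprMn.
  rewrite ler_sqr ?nnegrE ?mulr_ge0 ?(ltW hp) ?(ltW g0) ?(ltW e10)//.
  rewrite [leRHS]mulrC -mulrA ler_wpM2l ?(ltW g0)//.
  apply: (le_trans (ler_wpM2l (ltW hp) Bv)).
  by rewrite mulrCA ger_pMr// mulrC.
set S := delta + e * g.
have Ce : Ca * 2 `^ a * e1 * g + e1 * g <= e * g.
  rewrite -mulrDl ler_wpM2r ?(ltW g0)//.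
  rewrite -{2}[e1]mul1r -mulrDl -/C mulrC -ler_pdivlMr//.
  by rewrite ge_min lexx.
have p1 : 0 <= Ca * 2 `^ a * e1 * g.
  by rewrite !mulr_ge0 ?powR_ge0 ?(ltW e10).
have p2 : 0 <= e1 * g by rewrite mulr_ge0 ?ltW.
have S0 : 0 <= S by rewrite addr_ge0 ?mulr_ge0 ?ltW.
have tot : `|F v - fd| ^+ 2 + penalty_of_scale a h * `|B (v - ubar)| ^+ 2 <= S ^+ 2.
  apply: (@le_trans _ _ ((delta + Ca * 2 `^ a * e1 * g) ^+ 2 + (e1 * g) ^+ 2)).
    by rewrite lerD// ler_sqr ?nnegrE ?addr_ge0// ltW.
  apply: (@le_trans _ _ ((delta + Ca * 2 `^ a * e1 * g + e1 * g) ^+ 2)).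
    rewrite [leRHS]sqrrD lerD2r lerDl mulrn_wge0// mulr_ge0// addr_ge0//; exact: ltW.
  have q1 : 0 <= delta + Ca * 2 `^ a * e1 * g + e1 * g by rewrite !addr_ge0 ?(ltW d0).
  by rewrite ler_sqr ?nnegrE// /S -addrA lerD2l.
have tot' := le_trans le tot.
split=> //.
- rewrite -ler_sqr ?nnegrE//; apply: le_trans tot'.
  by rewrite lerDl mulr_ge0 ?sqr_ge0 ?(ltW p0).
- rewrite -ler_sqr ?nnegrE ?mulr_ge0 ?(ltW hp) ?(ltW g0)//; apply: le_trans tot'.
  by rewrite exprMn /penalty_of_scale -/g exprMn [h ^+ 2 * _]mulrC lerDr sqr_ge0.
Qed.

(** With [n] of order [1 / h], the factor [n `^ a] cancels the bound
    [O(delta) = O(eta * h `^ a)] for the negative norm of the error, and [1 / n]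
    cancels the bound [O(eta / h)] for [B (u - ubar)]. *)
Lemma error_small_parameter (e : R) : 0 < e -> exists2 eta : R, 0 < eta &
  exists2 h0 : R, 0 < h0 &
  forall (h delta : R) fd u, 0 < h <= h0 -> 0 < delta -> `|fd - fdag| <= delta ->
  minimizer DF (J fd (penalty_of_scale a h)) u -> delta <= eta * h `^ a ->
  `|F u - fd| <= b * delta -> `|u - udag| <= e.
Proof.
move=> e0.
have b0 : 0 < b by rewrite (lt_trans ltr01).
pose C := K * ((b + 1) / ca + 4) + 1.
have C0 : 0 < C.
  by rewrite addr_gt0// mulr_gt0// addr_gt0// divr_gt0// addr_gt0.
pose eta := e / C; have eta0 : 0 < eta by rewrite divr_gt0.
have [h1 h10 h1P] := minimizer_bounds eta0.
have [n0 n0P] := approx eta0.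
have [h2 h20 h2P] := index_of_scale (R := R) n0.
exists eta => //; exists (Num.min h1 h2); first by rewrite lt_min h10.
move=> h delta fd u /andP[h0 hh] d0 fdd umin dle Fu.
have hh1 : 0 < h <= h1 by rewrite h0 (le_trans hh)// ge_min lexx.
have hh2 : 0 < h <= h2 by rewrite h0 (le_trans hh)// ge_min lexx orbT.
have [DFu Du _ Bu] := h1P _ _ _ _ hh1 d0 fdd umin.
have [n nn0 /andP[nh1 nh2]] := h2P _ hh2.
have [np _ err] := n0P _ nn0.
have nR : 0 < n%:R :> R by rewrite ltr0n.
set g := h `^ a in dle Bu; have g0 : 0 < g by rewrite powR_gt0.
have ng : n%:R `^ a * g <= 1.
  rewrite -powRM ?(ltW h0)// -[leRHS](_ : 1 `^ a = 1); last by rewrite powR1.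
  by rewrite ge0_ler_powR ?nnegrE ?(ltW a_gt0)// mulr_ge0// ltW.
have Fu' : `|F u - fdag| <= (b + 1) * delta.
  by rewrite -(subrKA fd) (le_trans (ler_normD _ _))// mulrDl mul1r lerD.
have t1 : n%:R `^ a * N (u - udag) <= (b + 1) / ca * eta.
  have /andP[+ _] := F_cond DFu (domain_shift Du); move=> cN.
  have Nu : N (u - udag) <= (b + 1) / ca * delta.
    by rewrite mulrAC ler_pdivlMr// mulrC (le_trans cN).
  apply: (le_trans (ler_wpM2l (powR_ge0 _ _) Nu)).
  rewrite mulrCA ler_wpM2l ?divr_ge0 ?addr_ge0 ?(ltW b0) ?(ltW ca_gt0)//.
  apply: (le_trans (ler_wpM2l (powR_ge0 _ _) dle)).
  by rewrite mulrCA ger_pMr.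
have t2 : `|B (u - ubar)| / n%:R <= 4 * eta.
  rewrite ler_pdivrMr//.
  have Bg : h * `|B (u - ubar)| <= 2 * eta.
    rewrite -(ler_pM2l g0) mulrCA mulrA (le_trans Bu)//.
    by rewrite mulrCA mulr_natl mulr2n [g * _]mulrC lerD.
  rewrite -(ler_pM2l h0) (le_trans Bg)//.
  rewrite [leRHS](_ : _ = 2 * eta * (2 * n%:R * h)); last by ring.
  by rewrite ler_peMr// mulr_ge0// ltW.
apply: (le_trans (err _ Du)).
apply: (@le_trans _ _ (K * ((b + 1) / ca * eta + 4 * eta) + eta)).
  by rewrite lerD2r ler_wpM2l ?(ltW K_gt0)// lerD.
rewrite -mulrDl mulrA -{2}[eta]mul1r -mulrDl -/C /eta mulrC divfK// gt_eqF//.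
Qed.

(** When [B (u - ubar)] stays bounded, the index [n] is fixed first, so large that
    the term [K * L / n] is small; the remaining term [n `^ a * N (u - udag)] is
    [O(delta)] for this [n]. *)
Lemma error_large_parameter (e L : R) : 0 < e -> 0 <= L -> exists2 d0 : R, 0 < d0 &
  forall (delta : R) u, 0 < delta < d0 -> DF u -> DB (u - ubar) ->
  `|B (u - ubar)| <= L -> `|F u - fdag| <= (b + 1) * delta -> `|u - udag| <= e.
Proof.
move=> e0 L0; have e30 : 0 < e / 3 by rewrite divr_gt0.
have b0 : 0 < b by rewrite (lt_trans ltr01).
have [n0 n0P] := approx e30.
pose t := K * L / (e / 3); have t0 : 0 <= t.
  by rewrite divr_ge0 ?mulr_ge0 ?(ltW K_gt0)// ltW.
pose n := maxn n0 (Num.bound t).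
have [np _ err] := n0P n (leq_maxl _ _).
have nR : 0 < n%:R :> R by rewrite ltr0n.
have na0 : 0 < n%:R `^ a :> R by rewrite powR_gt0.
pose C := K * (n%:R `^ a * ((b + 1) / ca)).
have C0 : 0 < C by rewrite !mulr_gt0 ?invr_gt0// addr_gt0.
exists (e / 3 / C) => [|delta u /andP[d0 dd] DFu Du BL Fu]; first by rewrite divr_gt0.
have := F_cond DFu (domain_shift Du); move=> /andP[cN _].
have Nu : N (u - udag) <= (b + 1) / ca * delta.
  by rewrite mulrAC ler_pdivlMr// mulrC (le_trans cN).
apply: (le_trans (err _ Du)).
have t1 : K * (n%:R `^ a * N (u - udag)) <= e / 3.
  apply: (@le_trans _ _ (C * delta)).
    by rewrite /C -!mulrA ler_pM2l// ler_pM2l// mulrA.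
  by rewrite mulrC -ler_pdivlMr// ltW.
have t2 : K * (`|B (u - ubar)| / n%:R) <= e / 3.
  rewrite mulrA ler_pdivrMr// (@le_trans _ _ (K * L))//.
    by rewrite ler_wpM2l// ltW.
  rewrite -ler_pdivrMl// mulrC -/t (le_trans (ltW (archi_boundP t0)))//.
  by rewrite ler_nat leq_maxr.
rewrite mulrDr.
apply: (@le_trans _ _ (e / 3 + e / 3 + e / 3)); first by rewrite lerD2r lerD.
by rewrite [leLHS](_ : _ = e)//; field.
Qed.

End Tikhonov.

(** * Convergence of the discrepancy principle *)

Theorem theorem4p9 (R : realType) (X Y : completeNormedModType R)
  (ipX : {dot X for idfun}) (ipY : {dot Y for idfun})
  (hilbX : hilbert_norm ipX) (hilbY : hilbert_norm ipY)
  (infX : infinite_dimensional X) (infY : infinite_dimensional Y)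
  (DB : set X) (B : X -> X) (m : R)
  (B_lin : linear_on DB B) (B_dense : dense DB)
  (B_sa : selfadjoint ipX DB B) (B_pos : positive_definite ipX DB B)
  (B_unb : unbounded DB B)
  (m_gt0 : 0 < m) (B_below : forall u : X, DB u -> m * `|u| <= `|B u|)
  (DF : set X) (F : X -> Y)
  (F_weak : weakly_seq_continuous DF F)
  (DF_closed : closed DF) (DF_convex : convex_set DF)
  (D_neq0 : DF `&` DB !=set0)
  (udag : X) (fdag : Y)
  (udag_DF : DF udag) (F_udag : F udag = fdag) (udag_int : (interior DF) udag)
  (ubar : X) (ubar_D : (DF `&` DB) ubar)
  (a ca Ca : R) (a_gt0 : 0 < a) (ca_gt0 : 0 < ca) (ca_le : ca <= Ca)
  (F_cond : forall u : X, (DF `&` DB) u ->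
     ca * norm_neg DB B a (u - udag) <= `|F u - fdag|
       <= Ca * norm_neg DB B a (u - udag))
  (b c : R) (b_gt1 : 1 < b) (c_gt1 : 1 < c)
  (fdelta : R -> Y)
  (fdelta_close : forall delta : R, 0 < delta -> `|fdelta delta - fdag| <= delta)
  (u : R -> R -> X)
  (u_min : forall delta alpha : R, 0 < delta -> 0 < alpha ->
     minimizer DF (tikhonov DB B F ubar (fdelta delta) alpha) (u delta alpha))
  (alphastar : R -> \bar R)
  (alphastar_dp : forall delta : R, 0 < delta ->
     discrepancy_principle F ubar b c delta (fdelta delta) (u delta)
       (alphastar delta)) :
  `|reg_sol ubar (u delta) (alphastar delta) - udag| @[delta --> 0^'+] --> 0
  /\
  delta_ratio (a / (2 * a + 2)) delta (alphastar delta) @[delta --> 0^'+] --> 0.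
Proof.
have [DFubar DBubar] := ubar_D.
have DB0 : DB 0 := domain0 B_lin.
have DB_add u0 v0 : DB u0 -> DB v0 -> DB (u0 + v0) by exact: (domainD B_lin).
have B0 : B 0 = 0 by have := operatorB B_lin DB0 DB0; rewrite !subrr.
have Ca0 : 0 <= Ca by rewrite (le_trans (ltW ca_gt0)).
have b0 : 0 < b by rewrite (lt_trans ltr01).
have c0 : 0 < c by rewrite (lt_trans ltr01).
have Fc u0 : DF u0 -> DB u0 -> ca * norm_neg DB B a (u0 - udag) <= `|F u0 - fdag|
    <= Ca * norm_neg DB B a (u0 - udag) by move=> ? ?; exact: F_cond.
have [K K0 approx] := hilbert_scale_approx hilbX B_lin B_sa B_dense B_pos m_gt0
  B_below a_gt0 udag ubar.
pose q := (2 * a + 2)^-1; pose c1 := c `^ q.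
have c10 : 0 < c1 by exact: powR_gt0.
have c1a0 : 0 < c1 `^ a by exact: powR_gt0.
have b10 : 0 < b - 1 by rewrite subr_gt0.
have q0 : 0 < q by rewrite invr_gt0 addr_gt0// mulr_gt0.
suff main (e : R) : 0 < e -> exists2 d0 : R, 0 < d0 & forall delta : R, 0 < delta < d0 ->
    `|reg_sol ubar (u delta) (alphastar delta) - udag| <= e /\
    0 <= delta_ratio (a / (2 * a + 2)) delta (alphastar delta) <= e.
  have near_main e : 0 < e -> \forall delta \near 0^'+,
      `|reg_sol ubar (u delta) (alphastar delta) - udag| <= e /\
      0 <= delta_ratio (a / (2 * a + 2)) delta (alphastar delta) <= e.
    move=> /main[d0 d00 h]; near=> delta; apply: h; apply/andP; split.
      by near: delta; exact: nbhs_right_gt.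
    by near: delta; exact: nbhs_right_lt.
  split; apply/cvgrPdist_le => e /near_main; apply: filterS => delta [h /andP[r0 r1]].
    by rewrite sub0r normrN normr_id.
  by rewrite sub0r normrN ger0_norm.
move=> e0.
have [eta eta0 [h0 h00 small]] := error_small_parameter DB_add DBubar udag_int
  a_gt0 b_gt1 ca_gt0 Ca0 Fc K0 approx e0.
pose eta' := Num.min eta e.
have eta'0 : 0 < eta' by rewrite lt_min eta0.
have eta10 : 0 < eta' * (b - 1) / c1 `^ a by rewrite divr_gt0// mulr_gt0.
have [h1 h10 resid] := minimizer_bounds DB_add DBubar udag_int a_gt0 Ca0 Fc approx eta10.
pose h2 := Num.min h0 h1; have h20 : 0 < h2 by rewrite lt_min h00.
pose h3 := h2 / c1; have h30 : 0 < h3 by rewrite divr_gt0.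
have h3a0 : 0 < h3 `^ a by exact: powR_gt0.
pose L := (`|F ubar - fdag| + 1) / (h3 * h3 `^ a).
have L0 : 0 <= L by rewrite divr_ge0 ?addr_ge0// ltW// mulr_gt0.
have [d1 d10 large] := error_large_parameter DB_add DBubar b_gt1 ca_gt0 Fc
  K0 approx e0 L0.
exists (Num.min (Num.min d1 1) (e * h3 `^ a)).
  by rewrite !lt_min d10 ltr01 mulr_gt0.
move=> delta /andP[d0]; rewrite !lt_min => /andP[/andP[dd1 d1'] de].
have := alphastar_dp _ d0; have fd := fdelta_close _ d0.
set f := fdelta delta in fd *; rewrite /discrepancy_principle.
have Fdag x : `|F x - f| <= b * delta -> `|F x - fdag| <= (b + 1) * delta.
  move=> Fx; rewrite -(subrKA f) (le_trans (ler_normD _ _))//.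
  by rewrite mulrDl mul1r lerD.
case: ifPn => [Fub ->|_ [r [-> r0 Fr [s /andP[rs sr] Fs]]]] /=.
  split; last by rewrite lexx ltW.
  apply: (large delta) => //; rewrite ?d0// ?subrr ?B0 ?normr0//.
  exact: Fdag.
have s0 : 0 < s by exact: lt_le_trans rs.
have [hs hs0 [hsE hsp _]] := penalty_of_scaleP a_gt0 s0.
have [hr hr0 [hrE hrp ->]] := penalty_of_scaleP a_gt0 r0.
have hra0 : 0 < hr `^ a by exact: powR_gt0.
have hsa0 : 0 < hs `^ a by exact: powR_gt0.
have hrs : hr <= hs.
  by rewrite hrE hsE ge0_ler_powR ?nnegrE// ltW// (lt_le_trans r0).
have hsc : hs <= c1 * hr.
  rewrite hrE hsE /c1 -powRM ?(ltW r0) ?(ltW c0)//.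
  by rewrite ge0_ler_powR ?nnegrE ?(ltW q0) ?(ltW s0)// mulr_ge0 ?(ltW c0) ?(ltW r0).
have minr : minimizer DF (tikhonov DB B F ubar f r) (u delta r) by exact: u_min.
have mins : minimizer DF (tikhonov DB B F ubar f (penalty_of_scale a hs)) (u delta s).
  by rewrite hsp; exact: u_min.
(* The scale [hs] of the upper parameter decides, since the lower bound on the
   residual is available there; [hr] and [hs] agree up to the factor [c1]. *)
have [hsmall|hlarge] := leP hs h2.
  have hs1 : 0 < hs <= h1 by rewrite hs0 (le_trans hsmall)// ge_min lexx orbT.
  have [_ _ Fs' _] := resid _ _ _ _ hs1 d0 fd mins.
  have dle : delta <= eta' * hr `^ a.
    have : (b - 1) * delta <= eta' * (b - 1) / c1 `^ a * hs `^ a.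
      by rewrite mulrBl mul1r lerBlDl; exact: (le_trans Fs Fs').
    have : hs `^ a <= c1 `^ a * hr `^ a.
      rewrite -powRM ?(ltW c10) ?(ltW hr0)//.
      by rewrite ge0_ler_powR ?nnegrE ?(ltW a_gt0) ?(ltW hs0)// mulr_ge0 ?(ltW c10) ?(ltW hr0).
    move=> hh hd; rewrite -(ler_pM2l b10) (le_trans hd)//.
    apply: (le_trans (ler_wpM2l (ltW eta10) hh)).
    by rewrite mulrA divfK ?gt_eqF// mulrCA mulrA.
  split; last first.
    rewrite divr_ge0 ?(ltW d0) ?(ltW hra0)//= ler_pdivrMr//.
    by rewrite (le_trans dle)// ler_wpM2r ?(ltW hra0)// ge_min lexx orbT.
  apply: (small hr delta f) => //.
  - by rewrite hr0 (le_trans hrs)// (le_trans hsmall)// ge_min lexx.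
  - by rewrite hrp.
  - by rewrite (le_trans dle)// ler_wpM2r ?(ltW hra0)// ge_min lexx.
have h3r : h3 <= hr by rewrite ler_pdivrMr// mulrC (le_trans (ltW hlarge)).
have h3ra : h3 `^ a <= hr `^ a.
  by rewrite ge0_ler_powR ?nnegrE ?(ltW a_gt0) ?(ltW h30) ?(ltW hr0).
split; last first.
  rewrite divr_ge0 ?(ltW d0) ?(ltW hra0)//= ler_pdivrMr// (le_trans (ltW de))//.
  by rewrite ler_pM2l.
have Du0 : DB (ubar - ubar) by rewrite subrr.
have [DFu Du] := minimizer_le r0 minr DFubar Du0.
rewrite subrr B0 normr0 expr0n mulr0 addr0 => le.
apply: (large delta) => //; [by rewrite d0| |exact: Fdag].
have h33 : 0 < h3 * h3 `^ a by exact: mulr_gt0.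
rewrite /L ler_pdivlMr//.
have Fub : `|F ubar - f| <= `|F ubar - fdag| + 1.
  rewrite -(subrKA fdag) (le_trans (ler_normD _ _))// lerD2l distrC.
  by rewrite (le_trans fd)// ltW.
apply: le_trans Fub; rewrite mulrC.
apply: (@le_trans _ _ (hr * hr `^ a * `|B (u delta r - ubar)|)).
  by rewrite ler_wpM2r// ler_pM// ltW.
rewrite -ler_sqr ?nnegrE ?mulr_ge0 ?(ltW hr0) ?(ltW hra0)//.
rewrite exprMn; apply: le_trans le; rewrite -hrp /penalty_of_scale.
by rewrite exprMn [hr ^+ 2 * _]mulrC lerDr sqr_ge0.
Unshelve. all: by end_near.
Qed.
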